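(* Let $r,n,q,k\ge1$ be natural numbers. Then there exist rational numbers $l_i,c_j$ (depending on $n,r,k$, and $q$) such that $$\int_{0}^{1}\frac{x^{2n-1}\ln^{q}(x)}{(1+x^{2})^{r}}\,dx=l_{0}\ln2+\sum_{i=1}^{q}l_{i}\zeta(i+1)+l_{q+1},$$ $$\int_{0}^{1}\frac{x^{2n}\ln^{2k-1}(x)}{(1+x^{2})^{r}}\,dx=l_{0}G+\sum_{i=1}^{k}l_{i}\pi^{2i-1}+\sum_{j=2}^{k}c_{j}\left(\psi^{(2j-1)}\Big(\frac{1}{4}\Big)-\psi^{(2j-1)}\Big(\frac{3}{4}\Big)\right)+l_{k+1},$$ $$\int_{0}^{1}\frac{x^{2n}\ln^{2k}(x)}{(1+x^{2})^{r}}\,dx=l_{0}G+\sum_{i=1}^{k+1}l_{i}\pi^{2i-1}+\sum_{j=2}^{k}c_{j}\left(\psi^{(2j-1)}\Big(\frac{1}{4}\Big)-\psi^{(2j-1)}\Big(\frac{3}{4}\Big)\right)+l_{k+2}.$$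
   Context: $G$ is Catalan's constant, $\zeta$ the Riemann zeta function, and $\psi^{(m)}$ the polygamma function (the $m$-th derivative of $\psi^{(0)}=\Gamma'/\Gamma$). *)

(* Defs.v *)
From Stdlib Require Export Reals QArith Qreals.
From Coquelicot Require Export Coquelicot.
Open Scope R_scope.

Definition catalan : R :=
  Series (fun n : nat => (-1) ^ n / INR (2 * n + 1) ^ 2).

(* The Dirichlet series, which represents the Riemann zeta function for real
   [s > 1]; for [s <= 1] the value is meaningless (no analytic continuation). *)
Definition zeta (s : R) : R :=
  Series (fun n : nat => / Rpower (INR (n + 1)) s).

(* Euler's integral over (0, +oo), improper at both ends; meaningful for
   [x > 0]. *)
Definition Gamma (x : R) : R :=
  RInt_gen (fun t : R => Rpower t (x - 1) * exp (- t))
           (at_right 0) (Rbar_locally p_infty).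

Definition digamma (x : R) : R := Derive Gamma x / Gamma x.

Definition polygamma (m : nat) (x : R) : R := Derive_n digamma m x.

(* Main.v *)
Require Import Defs.
From Stdlib Require Import Reals QArith Qreals Lra Lia Psatz.
From Coquelicot Require Import Coquelicot.
Open Scope R_scope.

(** Write I(m,p,r) for the integral of [x^m ln^p x / (1+x^2)^r] over [0,1], [m >= 1].
    Integrating the derivative of [x^(m+1) ln^p x / (1+x^2)^r] expresses I(m,p,r+1) through
    I(m,p,r), I(m,p-1,r) and a rational, and [x^2 = (1+x^2) - 1] lowers [m] by 2 when [r = 1];
    so only I(1,p,1) and I(2,p,1) matter.  Expanding [1/(1+x^2)] geometrically turns the
    former into the alternating zeta value at [p+1] and the latter into the Dirichlet beta
    value beta(p+1).

    For odd arguments beta(2n+1) is a rational multiple of [PI^(2n+1)]: summing the moments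
    of [v^(2i)] against [cos ((2j+1) v)] on [0, PI/2] over [j] gives [0] for [i >= 1], since
    the cosines add up to [sin (2 N v) / (2 sin v)], which oscillates; evaluating each moment
    by parts yields a recurrence between the odd beta values.

    For even arguments, convexity in the form [Gamma (s+l) <= s^l Gamma s] together with
    [Gamma (s+1) = s Gamma s] gives Euler's series for [ln Gamma] on (0,1).  Differentiating
    it termwise shows that the polygamma values are Hurwitz sums, and the difference of those
    at 1/4 and 3/4 is the series of beta. *)

(** The statement asks for integrability and not only for a value. As the exponent of x is at least
    1 and [ln] is 0 on nonpositive reals, every integrand is continuous on [0,1], so the left-hand
    sides are proper integrals. The recurrences never raise the power of the logarithm, so an
    integral with ln^p x only involves ln 2, or zeta or beta values at arguments up to p+1; this
    fixes the ranges of the sums. The admissible right-hand sides form a rational subspace, so the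
    reduction is done once for an arbitrary such subspace.

    [Gamma] is an improper integral and [polygamma] is built from the total function [Derive], so
    convergence, positivity and differentiability all have to be earned. Differentiability comes
    last: the series of ln Gamma follows from relations between values of Gamma alone, and the
    derivatives are read off that series instead of being taken under the integral. Everything stays
    on (0,1), which contains 1/4 and 3/4. *)

Lemma is_RInt_Rplus (f g : R -> R) (a b x y : R) :
  is_RInt f a b x -> is_RInt g a b y -> is_RInt (fun t => f t + g t) a b (x + y).
Proof. exact (@is_RInt_plus R_NormedModule f g a b x y). Qed.

Lemma is_RInt_Rminus (f g : R -> R) (a b x y : R) :
  is_RInt f a b x -> is_RInt g a b y -> is_RInt (fun t => f t - g t) a b (x - y).
Proof. exact (@is_RInt_minus R_NormedModule f g a b x y). Qed.

Lemma is_RInt_Rscal (f : R -> R) (a b k x : R) :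
  is_RInt f a b x -> is_RInt (fun t => k * f t) a b (k * x).
Proof. exact (@is_RInt_scal R_NormedModule f a b k x). Qed.

Lemma is_RInt_Rconst (a b c : R) : is_RInt (fun _ => c) a b ((b - a) * c).
Proof. exact (@is_RInt_const R_NormedModule a b c). Qed.

Lemma is_RInt_Runique (f : R -> R) (a b x y : R) :
  is_RInt f a b x -> is_RInt f a b y -> x = y.
Proof.
  intros Hx Hy; apply (@is_RInt_unique R_CompleteNormedModule) in Hx, Hy; congruence.
Qed.

Lemma is_RInt_Rderive (f df : R -> R) (a b : R) :
  a <= b ->
  (forall x, a <= x <= b -> is_derive f x (df x)) ->
  (forall x, a <= x <= b -> continuous df x) ->
  is_RInt df a b (f b - f a).
Proof.
  intros Hab Hd Hc.
  apply (@is_RInt_derive R_CompleteNormedModule f df);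
    rewrite Rmin_left, Rmax_right by assumption; assumption.
Qed.

Lemma continuous_Rplus (f g : R -> R) (x : R) :
  continuous f x -> continuous g x -> continuous (fun t => f t + g t) x.
Proof. exact (@continuous_plus R_UniformSpace R_AbsRing R_NormedModule f g x). Qed.

Lemma continuous_Rscal (f : R -> R) (k x : R) :
  continuous f x -> continuous (fun t => k * f t) x.
Proof. exact (@continuous_scal_r R_UniformSpace R_AbsRing R_NormedModule k f x). Qed.

Lemma is_series_unique_R (a : nat -> R) (x y : R) :
  is_series a x -> is_series a y -> x = y.
Proof. intros Hx Hy; apply is_series_unique in Hx, Hy; congruence. Qed.

Lemma is_series_Rext (a b : nat -> R) (x : R) :
  (forall n, a n = b n) -> is_series a x -> is_series b x.
Proof. exact (@is_series_ext R_AbsRing R_NormedModule a b x). Qed.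

Lemma is_series_Rplus (a b : nat -> R) (x y : R) :
  is_series a x -> is_series b y -> is_series (fun n => a n + b n) (x + y).
Proof. exact (@is_series_plus R_AbsRing R_NormedModule a b x y). Qed.

Lemma is_series_Rscal (a : nat -> R) (c x : R) :
  is_series a x -> is_series (fun n => c * a n) (c * x).
Proof. exact (@is_series_scal R_AbsRing R_NormedModule c a x). Qed.

Lemma pow_m1_sqr (p : nat) : (-1) ^ p * (-1) ^ p = 1.
Proof. rewrite <- Rpow_mult_distr. replace (-1 * -1) with 1 by ring. apply pow1. Qed.

(** * The integrals and their recurrences *)

Lemma pow_div_fact_le_exp (x : R) (n : nat) :
  0 <= x -> x ^ n / INR (Factorial.fact n) <= exp x.
Proof.
  intros Hx.
  apply Rle_trans with (2 := exp_ge_taylor x n Hx).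
  destruct n as [|n].
  - simpl; lra.
  - rewrite tech5.
    assert (0 <= sum_f_R0 (fun k => x ^ k / INR (Factorial.fact k)) n); [|lra].
    apply cond_pos_sum; intros k.
    apply Rmult_le_pos; [now apply pow_le|].
    left; apply Rinv_0_lt_compat, INR_fact_lt_0.
Qed.

Lemma ln_nonpos_arg (x : R) : x <= 0 -> ln x = 0.
Proof.
  intros Hx; unfold ln; destruct (Rlt_dec 0 x) as [H|H]; [exfalso; lra|reflexivity].
Qed.

(** With y = -ln x >= 0, one Taylor term gives y^(2p) / (2p)! <= exp y = 1/x; multiply by x^2 (2p)!.
    Squaring removes the sign of ln^p x, and the factor x that remains forces the limit 0. *)
Lemma mul_ln_pow_sqr_le (x : R) (p : nat) :
  0 < x <= 1 -> (x * ln x ^ p) ^ 2 <= x * INR (Factorial.fact (2 * p)).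
Proof.
  intros [Hx Hx1].
  assert (Hy : 0 <= - ln x).
  { destruct Hx1 as [H|H]; [assert (L := ln_increasing x 1 Hx H); rewrite ln_1 in L; lra | rewrite H, ln_1; lra]. }
  assert (H := pow_div_fact_le_exp (- ln x) (2 * p) Hy).
  rewrite exp_Ropp, exp_ln in H by assumption.
  assert (Hf := INR_fact_lt_0 (2 * p)).
  rewrite pow_mult in H.
  replace ((- ln x) ^ 2) with (ln x ^ 2) in H by ring.
  rewrite <- pow_mult, Nat.mul_comm, pow_mult in H.
  apply Rmult_le_compat_r with (r := x * x * INR (Factorial.fact (2 * p))) in H.
  2: { apply Rmult_le_pos; [nra|lra]. }
  rewrite (Nat.mul_comm p 2) in H.
  replace ((ln x ^ p) ^ 2 / INR (Factorial.fact (2 * p)) * (x * x * INR (Factorial.fact (2 * p))))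
    with ((x * ln x ^ p) ^ 2) in H by (field; lra).
  replace (/ x * (x * x * INR (Factorial.fact (2 * p))))
    with (x * INR (Factorial.fact (2 * p))) in H by (field; lra).
  exact H.
Qed.

(** The limit is two-sided: left of 0 the function vanishes for p >= 1 because [ln] is 0 there, and
    right of 0 the bound on the square gives the radius eps^2 / (2p)!. For p = 0 the function is
    x. *)
Lemma continuous_mul_ln_pow_0 (p : nat) : continuous (fun x => x * ln x ^ p) 0.
Proof.
  destruct p as [|p].
  { apply continuous_ext with (f := fun x : R => x).
    - intros x; symmetry; apply Rmult_1_r.
    - apply continuous_id. }
  apply filterlim_locally; intros eps.
  set (F := INR (Factorial.fact (2 * S p))).
  assert (HF : 0 < F) by apply INR_fact_lt_0.
  assert (He := cond_pos eps).
  assert (Hd : 0 < Rmin 1 (eps ^ 2 / F)).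
  { apply Rmin_glb_lt; [lra|]. apply Rdiv_lt_0_compat; nra. }
  exists (mkposreal _ Hd); intros x Hx.
  apply Rabs_lt_between' in Hx; simpl in Hx.
  assert (H1 := Rmin_l 1 (eps ^ 2 / F)); assert (H2 := Rmin_r 1 (eps ^ 2 / F)).
  simpl in H1, H2.
  change (Rabs (x * ln x ^ S p - 0 * ln 0 ^ S p) < eps).
  rewrite Rmult_0_l, Rminus_0_r.
  destruct (Rle_lt_dec x 0) as [H|H].
  { rewrite (ln_nonpos_arg x H), pow_ne_zero, Rmult_0_r, Rabs_R0 by lia. lra. }
  rewrite <- (Rabs_pos_eq eps) by lra.
  apply Rsqr_lt_abs_0.
  rewrite !Rsqr_pow2.
  apply Rle_lt_trans with (1 := mul_ln_pow_sqr_le x (S p) ltac:(lra)).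
  fold F.
  apply Rlt_le_trans with (eps ^ 2 / F * F); [|right; field; lra].
  apply Rmult_lt_compat_r; [assumption|simpl; lra].
Qed.

Lemma continuous_pow_ln_pow (m p : nat) (x : R) :
  0 <= x -> continuous (fun x => x ^ S m * ln x ^ p) x.
Proof.
  intros [Hx|Hx].
  - apply (ex_derive_continuous (fun x => x ^ S m * ln x ^ p)); auto_derive; auto.
  - subst x.
    apply continuous_ext with (f := fun x : R => x ^ m * (x * ln x ^ p)).
    { intros x; change (x ^ m * (x * ln x ^ p) = x * x ^ m * ln x ^ p); ring. }
    apply (continuous_mult (fun x => x ^ m)).
    + apply (ex_derive_continuous (fun x => x ^ m)); auto_derive; auto.
    + apply continuous_mul_ln_pow_0.
Qed.

Definition lnfrac (m p r : nat) (x : R) : R := x ^ m * ln x ^ p / (1 + x ^ 2) ^ r.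

Lemma one_plus_sqr_pow_pos (r : nat) (x : R) : 0 < (1 + x ^ 2) ^ r.
Proof. apply pow_lt; nra. Qed.

Lemma continuous_lnfrac (m p r : nat) (x : R) :
  0 <= x -> continuous (lnfrac (S m) p r) x.
Proof.
  intros Hx.
  apply (continuous_mult (fun x => x ^ S m * ln x ^ p)).
  - now apply continuous_pow_ln_pow.
  - apply (ex_derive_continuous (fun x => / (1 + x ^ 2) ^ r)).
    assert (H := one_plus_sqr_pow_pos r x).
    auto_derive; simpl in *; lra.
Qed.

Lemma ex_RInt_lnfrac (m p r : nat) : ex_RInt (lnfrac (S m) p r) 0 1.
Proof.
  apply (@ex_RInt_continuous R_CompleteNormedModule); intros z Hz.
  rewrite Rmin_left in Hz by lra.
  apply continuous_lnfrac; lra.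
Qed.

Definition lnint (m p r : nat) : R := RInt (lnfrac m p r) 0 1.

Lemma is_RInt_lnint (m p r : nat) : is_RInt (lnfrac (S m) p r) 0 1 (lnint (S m) p r).
Proof. apply (@RInt_correct R_CompleteNormedModule), ex_RInt_lnfrac. Qed.

(** The difference quotient of x g(x) at 0 is g(h), so continuity of g suffices. The product rule
    would ask for g'(0), which does not exist for g = x ln x. *)
Lemma is_derive_id_mul_0 (g : R -> R) :
  continuous g 0 -> is_derive (fun x => x * g x) 0 (g 0).
Proof.
  intros Hg.
  apply is_derive_Reals; intros eps Heps.
  apply filterlim_locally with (eps := mkposreal eps Heps) in Hg.
  destruct Hg as [d Hd].
  exists d; intros h Hh Hhd.
  replace (((0 + h) * g (0 + h) - 0 * g 0) / h - g 0) with (g h - g 0).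
  - apply (Hd h). change (Rabs (h - 0) < d). now rewrite Rminus_0_r.
  - rewrite Rplus_0_l. field. exact Hh.
Qed.

(** Differentiating the denominator produces x^(m+3) over the power r+1; writing x^2 = (1+x^2) - 1
    there splits it into the terms with r and r+1, so that all three terms carry x^(m+1). For p = 0
    the term with [pred p] has the factor 0. *)
Lemma is_derive_lnfrac (m p r : nat) (x : R) :
  0 <= x ->
  is_derive (lnfrac (S (S m)) p r) x
    ((INR (S (S m)) - 2 * INR r) * lnfrac (S m) p r x
     + INR p * lnfrac (S m) (pred p) r x
     + 2 * INR r * lnfrac (S m) p (S r) x).
Proof.
  intros [Hx|Hx].
  - assert (H := one_plus_sqr_pow_pos r x).
    unfold lnfrac. auto_derive.
    + simpl in *; repeat split; lra.
    + change (match m with O => 1 | S _ => INR m + 1 end) with (INR (S m)).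
      replace (x * (x * 1)) with (x ^ 2) by ring.
      (* This removes the truncated [pred r]: for r = 0 both sides are 0. *)
      assert (E : INR r * (1 + x ^ 2) ^ pred r = INR r * (1 + x ^ 2) ^ r / (1 + x ^ 2)).
      { destruct r as [|r]; [simpl; field; nra|].
        simpl pred; change ((1 + x ^ 2) ^ S r) with ((1 + x ^ 2) * (1 + x ^ 2) ^ r).
        field; nra. }
      rewrite E, (S_INR (S m)).
      change ((1 + x ^ 2) ^ S r) with ((1 + x ^ 2) * (1 + x ^ 2) ^ r).
      change (x ^ S m) with (x * x ^ m).
      set (u := (1 + x ^ 2) ^ r) in *.
      field; repeat split; nra.
  - subst x.
    apply is_derive_ext with (f := fun x => x * lnfrac (S m) p r x).
    { intros x; change (x * (x ^ S m * ln x ^ p / (1 + x ^ 2) ^ r) =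
        x * x ^ S m * ln x ^ p / (1 + x ^ 2) ^ r); unfold Rdiv; ring. }
    (* Both values are 0 because of the factor 0^(m+1). *)
    replace (_ + _ + _) with (lnfrac (S m) p r 0).
    + apply is_derive_id_mul_0, continuous_lnfrac; lra.
    + unfold lnfrac; rewrite !pow_ne_zero by lia.
      unfold Rdiv; rewrite !Rmult_0_l; ring.
Qed.

(** The factor [0 ^ p] is ln^p 1: the boundary term at 1 survives only for p = 0, where [0 ^ 0] is
    1. *)
Lemma lnint_recurrence (m p r : nat) :
  (INR (S (S m)) - 2 * INR r) * lnint (S m) p r
     + INR p * lnint (S m) (pred p) r
     + 2 * INR r * lnint (S m) p (S r)
  = 0 ^ p / 2 ^ r.
Proof.
  replace (0 ^ p / 2 ^ r) with (lnfrac (S (S m)) p r 1 - lnfrac (S (S m)) p r 0).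
  - eapply is_RInt_Runique.
    + apply is_RInt_Rplus; [apply is_RInt_Rplus|]; apply is_RInt_Rscal, is_RInt_lnint.
    + apply is_RInt_Rderive; [lra| |]; intros x Hx.
      * apply is_derive_lnfrac; lra.
      * apply continuous_Rplus; [apply continuous_Rplus|];
          apply continuous_Rscal, continuous_lnfrac; lra.
  - unfold lnfrac. rewrite ln_1, pow1, (pow_ne_zero (S (S m))) by lia.
    replace (1 + 1 ^ 2) with 2 by ring.
    unfold Rdiv; ring.
Qed.

(** For r = 0 the term with r+1 drops out of the recurrence, which leaves an induction on p
    alone. *)
Lemma lnint_moment (m p : nat) :
  lnint (S m) p 0 = (-1) ^ p * INR (Factorial.fact p) / INR (S (S m)) ^ S p.
Proof.
  assert (Hm : INR (S (S m)) <> 0) by now apply not_0_INR.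
  induction p as [|p IH].
  - assert (H := lnint_recurrence m 0 0); simpl pred in H.
    change (INR 0) with 0 in H.
    apply Rmult_eq_reg_l with (INR (S (S m))); [|assumption].
    transitivity (0 ^ 0 / 2 ^ 0).
    + rewrite <- H; ring.
    + simpl Factorial.fact; change (INR 1) with 1.
      set (a := INR (S (S m))) in *. simpl pow; field; assumption.
  - assert (H := lnint_recurrence m (S p) 0); simpl pred in H.
    rewrite IH in H. change (INR 0) with 0 in H.
    rewrite pow_ne_zero in H by lia.
    apply Rmult_eq_reg_l with (INR (S (S m))); [|assumption].
    assert (E : INR (S (S m)) * lnint (S m) (S p) 0 =
      - (INR (S p) * ((-1) ^ p * INR (Factorial.fact p) / INR (S (S m)) ^ S p))).
    { replace (INR (S (S m)) * lnint (S m) (S p) 0) with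
        (0 / 2 ^ 0 - INR (S p) * ((-1) ^ p * INR (Factorial.fact p) / INR (S (S m)) ^ S p)).
      - change (2 ^ 0) with 1; unfold Rdiv; ring.
      - rewrite <- H; ring. }
    rewrite E, fact_simpl, mult_INR.
    change ((-1) ^ S p) with (-1 * (-1) ^ p).
    change (INR (S (S m)) ^ S (S p)) with (INR (S (S m)) * INR (S (S m)) ^ S p).
    field. split; [apply pow_nonzero|]; assumption.
Qed.

Lemma lnint_shift (m p : nat) :
  lnint (S (S (S m))) p 1 = lnint (S m) p 0 - lnint (S m) p 1.
Proof.
  eapply is_RInt_Runique; [apply is_RInt_lnint|].
  eapply is_RInt_ext; [|apply is_RInt_Rminus; apply is_RInt_lnint].
  intros x _. change (lnfrac (S m) p 0 x - lnfrac (S m) p 1 x = lnfrac (S (S (S m))) p 1 x).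
  unfold lnfrac. simpl. field. nra.
Qed.

Lemma is_lim_seq_inv_INR_affine (a b : nat) :
  (0 < a)%nat -> is_lim_seq (fun n => / INR (a * n + b)) 0.
Proof.
  intros Ha.
  apply is_lim_seq_le_le_loc with (u := fun _ => 0) (w := fun n => / INR n).
  - exists 1%nat; intros n Hn; split.
    + left; apply Rinv_0_lt_compat, lt_0_INR; nia.
    + apply Rinv_le_contravar; [apply lt_0_INR; lia|apply le_INR; nia].
  - apply is_lim_seq_const.
  - change (Finite 0) with (Rbar_inv p_infty).
    apply is_lim_seq_inv; [apply is_lim_seq_INR|discriminate].
Qed.

(** On (0,1) the sign of ln^p x is constantly (-1)^p, so dropping the denominator enlarges the
    absolute value, and the moment p! / (m+2)^(p+1) is at most p! / (m+2). This decay already sends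
    the remainder of the geometric expansion to 0, for p = 0 as well. *)
Lemma Rabs_lnint_le (m p : nat) :
  Rabs (lnint (S m) p 1) <= INR (Factorial.fact p) * / INR (S (S m)).
Proof.
  apply Rle_trans with (Rabs (lnint (S m) p 0)).
  - replace (Rabs (lnint (S m) p 0)) with ((-1) ^ p * lnint (S m) p 0).
    2: { rewrite lnint_moment. unfold Rdiv. rewrite !Rabs_mult, pow_1_abs.
         rewrite !Rabs_pos_eq.
         - rewrite <- !Rmult_assoc, <- Rpow_mult_distr.
           replace (-1 * -1) with 1 by ring. rewrite pow1; ring.
         - left; apply Rinv_0_lt_compat, pow_lt, lt_0_INR; lia.
         - apply pos_INR. }
    assert (H : is_RInt (fun x => (-1) ^ p * lnfrac (S m) p 0 x) 0 1 ((-1) ^ p * lnint (S m) p 0))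
      by apply is_RInt_Rscal, is_RInt_lnint.
    assert (H' : is_RInt (fun x => (-1) ^ p * lnfrac (S m) p 1 x) 0 1 ((-1) ^ p * lnint (S m) p 1))
      by apply is_RInt_Rscal, is_RInt_lnint.
    assert (Hle : forall x, 0 < x < 1 ->
      0 <= (-1) ^ p * lnfrac (S m) p 1 x <= (-1) ^ p * lnfrac (S m) p 0 x).
    { intros x Hx. unfold lnfrac.
      assert (Hp : 0 <= (-1) ^ p * ln x ^ p).
      { rewrite <- Rpow_mult_distr. apply pow_le.
        assert (L := ln_increasing x 1 (proj1 Hx) (proj2 Hx)); rewrite ln_1 in L; lra. }
      assert (Hxm : 0 <= x ^ S m) by (apply pow_le; lra).
      assert (Hi : 0 < / (1 + x ^ 2) ^ 1 <= 1).
      { split; [apply Rinv_0_lt_compat; nra|].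
        rewrite <- Rinv_1 at 2; apply Rinv_le_contravar; nra. }
      assert (Hq : 0 <= x ^ S m * ((-1) ^ p * ln x ^ p)) by now apply Rmult_le_pos.
      replace ((-1) ^ p * (x ^ S m * ln x ^ p / (1 + x ^ 2) ^ 1)) with
        (x ^ S m * ((-1) ^ p * ln x ^ p) * / (1 + x ^ 2) ^ 1) by (unfold Rdiv; ring).
      replace ((-1) ^ p * (x ^ S m * ln x ^ p / (1 + x ^ 2) ^ 0)) with
        (x ^ S m * ((-1) ^ p * ln x ^ p)) by (simpl; field).
      split; nra. }
    assert (H0 : 0 <= (-1) ^ p * lnint (S m) p 1).
    { assert (H00 := is_RInt_Rconst 0 1 0); rewrite Rmult_0_r in H00.
      apply is_RInt_le with (2 := H00) (3 := H'); [lra|].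
      intros x Hx; now apply Hle. }
    apply Rle_trans with ((-1) ^ p * lnint (S m) p 1).
    + rewrite <- (Rabs_pos_eq _ H0), Rabs_mult, pow_1_abs; lra.
    + apply is_RInt_le with (2 := H') (3 := H); [lra|].
      intros x Hx; now apply Hle.
  - rewrite lnint_moment. unfold Rdiv. rewrite !Rabs_mult, pow_1_abs, Rmult_1_l.
    assert (Hm : 0 < INR (S (S m))) by (apply lt_0_INR; lia).
    rewrite (Rabs_pos_eq (INR _)) by apply pos_INR.
    apply Rmult_le_compat_l; [apply pos_INR|].
    rewrite Rabs_pos_eq by (left; apply Rinv_0_lt_compat, pow_lt; assumption).
    apply Rinv_le_contravar; [assumption|].
    rewrite <- (pow_1 (INR (S (S m)))) at 1.
    apply Rle_pow; [|lia]. rewrite S_INR. assert (P := pos_INR (S m)); lra.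
Qed.

Lemma lnint_partial_sum (m p N : nat) :
  lnint (S m) p 1 =
  sum_n (fun j => (-1) ^ j * lnint (S m + 2 * j) p 0) N
  + (-1) ^ S N * lnint (S m + 2 * S N) p 1.
Proof.
  induction N as [|N IH].
  - rewrite sum_O. simpl Nat.add. replace (m + 2)%nat with (S (S m)) by lia.
    rewrite Nat.add_0_r, lnint_shift. simpl; ring.
  - rewrite IH, sum_Sn.
    replace (S m + 2 * S (S N))%nat with (S (S (S (m + 2 * S N)))) by lia.
    rewrite lnint_shift.
    replace (S m + 2 * S N)%nat with (S (m + 2 * S N)) by lia.
    unfold plus; cbn -[Nat.mul lnint sum_n]. ring.
Qed.

(** The limit is taken on the explicit remainder instead of exchanging sum and integral. For m = 0
    the denominators are 2, 4, 6, ..., and for m = 1 they are 3, 5, 7, ... *)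
Lemma is_series_lnint (m p : nat) :
  is_series (fun j => (-1) ^ j / INR (m + 2 + 2 * j) ^ S p)
    ((-1) ^ p / INR (Factorial.fact p) * lnint (S m) p 1).
Proof.
  assert (Hf : INR (Factorial.fact p) <> 0) by apply INR_fact_neq_0.
  assert (H1 := pow_m1_sqr p).
  assert (H : is_series (fun j => (-1) ^ j * lnint (S m + 2 * j) p 0) (lnint (S m) p 1)).
  { change (is_lim_seq (sum_n (fun j => (-1) ^ j * lnint (S m + 2 * j) p 0)) (lnint (S m) p 1)).
    apply is_lim_seq_ext with
      (u := fun N => lnint (S m) p 1 - (-1) ^ S N * lnint (S m + 2 * S N) p 1).
    { intros N. rewrite (lnint_partial_sum m p N) at 1. ring. }
    rewrite <- (Rminus_0_r (lnint (S m) p 1)) at 1.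
    apply is_lim_seq_minus'; [apply is_lim_seq_const|].
    apply is_lim_seq_abs_0.
    apply is_lim_seq_le_le with (u := fun _ => 0)
      (w := fun N => INR (Factorial.fact p) * / INR (2 * N + (m + 4))).
    - intros N; split; [apply Rabs_pos|].
      rewrite Rabs_mult, pow_1_abs, Rmult_1_l.
      eapply Rle_trans; [apply (Rabs_lnint_le (m + 2 * S N) p)|].
      right; do 3 f_equal; lia.
    - apply is_lim_seq_const.
    - rewrite <- (Rmult_0_r (INR (Factorial.fact p))).
      apply (is_lim_seq_scal_l _ _ 0), is_lim_seq_inv_INR_affine; lia. }
  apply (is_series_scal ((-1) ^ p / INR (Factorial.fact p))) in H.
  revert H; apply is_series_ext; intros j.
  change (S m + 2 * j)%nat with (S (m + 2 * j)).
  rewrite lnint_moment.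
  replace (S (S (m + 2 * j))) with (m + 2 + 2 * j)%nat by lia.
  unfold scal; cbn -[pow INR Nat.mul Nat.add].
  unfold mult; cbn -[pow INR Nat.mul Nat.add].
  replace ((-1) ^ p / INR (Factorial.fact p) *
    ((-1) ^ j * ((-1) ^ p * INR (Factorial.fact p) / INR (m + 2 + 2 * j) ^ S p)))
    with (((-1) ^ p * (-1) ^ p) * ((-1) ^ j / INR (m + 2 + 2 * j) ^ S p)).
  - rewrite H1; ring.
  - field; split; [apply pow_nonzero, not_0_INR; lia|assumption].
Qed.

(** The power p = 0 is evaluated directly, since the corresponding zeta argument would be the pole
    1. *)
Lemma lnint_1_0_1 : lnint 1 0 1 = / 2 * ln 2.
Proof.
  eapply is_RInt_Runique; [apply is_RInt_lnint|].
  replace (/ 2 * ln 2) with (/ 2 * ln (1 + 1 ^ 2) - / 2 * ln (1 + 0 ^ 2)).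
  - apply (is_RInt_Rderive (fun x => / 2 * ln (1 + x ^ 2))); [lra| |]; intros x Hx.
    + unfold lnfrac; auto_derive; [nra|]. simpl; field; nra.
    + apply continuous_lnfrac; lra.
  - replace (1 + 1 ^ 2) with 2 by ring.
    replace (1 + 0 ^ 2) with 1 by ring.
    rewrite ln_1; ring.
Qed.

(** * Rational subspaces of the reals *)

Record Qsubspace (V : R -> Prop) : Prop := {
  Qsub_add : forall x y, V x -> V y -> V (x + y);
  Qsub_scal : forall (a : Q) x, V x -> V (Q2R a * x) }.

Definition rational (x : R) : Prop := exists a : Q, x = Q2R a.

Lemma rational_Z (z : Z) : rational (IZR z).
Proof. exists (inject_Z z). unfold Q2R; simpl; field. Qed.

Lemma rational_INR (n : nat) : rational (INR n).
Proof. rewrite INR_IZR_INZ; apply rational_Z. Qed.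

Lemma rational_plus (x y : R) : rational x -> rational y -> rational (x + y).
Proof. intros [a ->] [b ->]; exists (a + b)%Q; now rewrite Q2R_plus. Qed.

Lemma rational_mult (x y : R) : rational x -> rational y -> rational (x * y).
Proof. intros [a ->] [b ->]; exists (a * b)%Q; now rewrite Q2R_mult. Qed.

Lemma rational_opp (x : R) : rational x -> rational (- x).
Proof. intros [a ->]; exists (- a)%Q; now rewrite Q2R_opp. Qed.

Lemma rational_minus (x y : R) : rational x -> rational y -> rational (x - y).
Proof. intros; apply rational_plus; [|apply rational_opp]; assumption. Qed.

(** As [/ 0] is 0, this holds without a side condition, and [auto with rational] never has to show
    that a denominator is nonzero. *)
Lemma rational_inv (x : R) : rational x -> rational (/ x).
Proof.
  intros [a ->]; destruct (Qeq_dec a 0) as [H|H].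
  - rewrite (Qeq_eqR _ _ H).
    replace (Q2R 0) with 0 by (unfold Q2R; simpl; field).
    rewrite Rinv_0. apply (rational_Z 0).
  - exists (/ a)%Q; now rewrite Q2R_inv.
Qed.

Lemma rational_div (x y : R) : rational x -> rational y -> rational (x / y).
Proof. intros; apply rational_mult; [|apply rational_inv]; assumption. Qed.

Lemma rational_pow (x : R) (n : nat) : rational x -> rational (x ^ n).
Proof.
  intros H; induction n as [|n IH]; [apply (rational_Z 1)|now apply rational_mult].
Qed.

Create HintDb rational.
#[local] Hint Resolve rational_Z rational_INR rational_plus rational_mult rational_opp
  rational_minus rational_inv rational_div rational_pow : rational.

Lemma Qsubspace_scal (V : R -> Prop) (a x : R) :
  Qsubspace V -> rational a -> V x -> V (a * x).
Proof. intros HV [b ->] Hx; now apply Qsub_scal. Qed.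

Lemma Qsubspace_rational (V : R -> Prop) (a : R) :
  Qsubspace V -> V 1 -> rational a -> V a.
Proof. intros HV H1 Ha; rewrite <- (Rmult_1_r a); now apply Qsubspace_scal. Qed.

Lemma lnint_moment_rational (m p : nat) : rational (lnint (S m) p 0).
Proof. rewrite lnint_moment; auto with rational. Qed.

Lemma Qsubspace_lnint_shift (V : R -> Prop) (m p i : nat) :
  Qsubspace V -> V 1 -> V (lnint (S m) p 1) -> V (lnint (S m + 2 * i) p 1).
Proof.
  intros HV H1 H; induction i as [|i IH].
  - now rewrite Nat.mul_0_r, Nat.add_0_r.
  - replace (S m + 2 * S i)%nat with (S (S (S (m + 2 * i)))) by lia.
    rewrite lnint_shift; unfold Rminus.
    apply (Qsub_add V HV).
    + apply Qsubspace_rational; auto using lnint_moment_rational.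
    + replace (- lnint (S (m + 2 * i)) p 1) with (-1 * lnint (S (m + 2 * i)) p 1) by ring.
      apply Qsubspace_scal; [assumption|apply rational_Z|exact IH].
Qed.

(** Solving the recurrence for the power r+1 divides by 2r, so the induction climbs from the power
    1. It never raises p, hence a single bound [P] serves throughout. *)
Lemma Qsubspace_lnint (V : R -> Prop) (m P r p : nat) :
  Qsubspace V -> V 1 ->
  (forall p, (p <= P)%nat -> V (lnint (S m) p 1)) ->
  (p <= P)%nat -> V (lnint (S m) p (S r)).
Proof.
  intros HV H1 H; revert p; induction r as [|r IH]; intros p Hp; [now apply H|].
  assert (E := lnint_recurrence m p (S r)).
  assert (Hr : INR (S r) <> 0) by now apply not_0_INR.
  replace (lnint (S m) p (S (S r))) with
    (0 ^ p / 2 ^ S r / (2 * INR (S r))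
     + (- ((INR (S (S m)) - 2 * INR (S r)) / (2 * INR (S r))) * lnint (S m) p (S r)
        + - (INR p / (2 * INR (S r))) * lnint (S m) (pred p) (S r))).
  - apply (Qsub_add V HV); [|apply (Qsub_add V HV)].
    + apply Qsubspace_rational; auto 10 with rational.
    + apply Qsubspace_scal; auto 10 with rational.
    + apply Qsubspace_scal; auto 10 with rational. apply IH; lia.
  - rewrite <- E. field; assumption.
Qed.

(** * The beta function at odd arguments *)

Definition beta (s : nat) : R := Series (fun j => (-1) ^ j / INR (2 * j + 1) ^ s).

(** The series of [lnint 2 p 1] starts at denominator 3: it is the beta series without its first
    term 1 and with the opposite signs. *)
Lemma is_series_beta_lnint (p : nat) :
  is_series (fun j => (-1) ^ j / INR (2 * j + 1) ^ S p)
    (1 - (-1) ^ p / INR (Factorial.fact p) * lnint 2 p 1).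
Proof.
  apply is_series_decr_1.
  assert (H := is_series_Rscal _ (-1) _ (is_series_lnint 1 p)).
  replace (plus _ _) with (-1 * ((-1) ^ p / INR (Factorial.fact p) * lnint 2 p 1)).
  - revert H; apply is_series_Rext; intros j.
    replace (1 + 2 + 2 * j)%nat with (2 * S j + 1)%nat by lia.
    change ((-1) ^ S j) with (-1 * (-1) ^ j). unfold Rdiv; ring.
  - change (-1 * ((-1) ^ p / INR (Factorial.fact p) * lnint 2 p 1) =
      1 - (-1) ^ p / INR (Factorial.fact p) * lnint 2 p 1
      + - ((-1) ^ 0 / INR (2 * 0 + 1) ^ S p)).
    change (INR (2 * 0 + 1)) with 1. rewrite pow1. simpl (_ ^ 0). field.
    apply INR_fact_neq_0.
Qed.

Lemma is_series_beta (p : nat) :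
  is_series (fun j => (-1) ^ j / INR (2 * j + 1) ^ S p) (beta (S p)).
Proof. apply Series_correct; eexists; apply is_series_beta_lnint. Qed.

Lemma lnint_2_beta (p : nat) :
  lnint 2 p 1 = (-1) ^ p * INR (Factorial.fact p) * (1 - beta (S p)).
Proof.
  assert (Hf : INR (Factorial.fact p) <> 0) by apply INR_fact_neq_0.
  rewrite (is_series_unique_R _ _ _ (is_series_beta p) (is_series_beta_lnint p)).
  assert (H1 := pow_m1_sqr p).
  transitivity (((-1) ^ p) * ((-1) ^ p) * lnint 2 p 1).
  - rewrite H1; ring.
  - field; assumption.
Qed.

(** Leibniz's series, by which [Alt_PI] is defined. It starts the induction on odd beta values. *)
Lemma beta_1 : beta 1 = PI / 4.
Proof.
  apply is_series_unique.
  rewrite <- Alt_PI_eq.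
  unfold Alt_PI; destruct exist_PI as [l Hl].
  replace (4 * l / 4) with l by field.
  apply is_series_Reals.
  intros eps Heps; destruct (Hl eps Heps) as [N HN].
  exists N; intros n Hn.
  replace (sum_f_R0 _ n) with (sum_f_R0 (tg_alt PI_tg) n).
  - now apply HN.
  - apply sum_eq; intros j _. unfold tg_alt, PI_tg. rewrite pow_1. reflexivity.
Qed.

Definition cosmom (i : nat) (w : R) : R := RInt (fun v => v ^ (2 * i) * cos (w * v)) 0 (PI / 2).

Lemma is_RInt_cosmom (i : nat) (w : R) :
  is_RInt (fun v => v ^ (2 * i) * cos (w * v)) 0 (PI / 2) (cosmom i w).
Proof.
  apply (@RInt_correct R_CompleteNormedModule).
  apply (@ex_RInt_continuous R_CompleteNormedModule); intros z _.
  apply (ex_derive_continuous (fun v => v ^ (2 * i) * cos (w * v))).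
  auto_derive; auto.
Qed.

Lemma cosmom_0 (w : R) : w <> 0 -> cosmom 0 w = sin (w * (PI / 2)) / w.
Proof.
  intros Hw.
  assert (HP := PI_RGT_0).
  eapply is_RInt_Runique; [apply is_RInt_cosmom|].
  replace (sin (w * (PI / 2)) / w) with (sin (w * (PI / 2)) / w - sin (w * 0) / w).
  - apply (is_RInt_Rderive (fun v => sin (w * v) / w)); [lra| |]; intros x _.
    + auto_derive; [auto|]. simpl; field; assumption.
    + apply (ex_derive_continuous (fun v => v ^ (2 * 0) * cos (w * v))).
      auto_derive; auto.
  - rewrite Rmult_0_r, sin_0. field; assumption.
Qed.

(** [F] performs two integrations by parts at once: the sine terms cancel in its derivative. The
    hypothesis on the cosine removes the second boundary term at PI/2. *)
Lemma cosmom_S (i : nat) (w : R) :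
  w <> 0 -> cos (w * (PI / 2)) = 0 ->
  cosmom (S i) w + INR (2 * i + 2) * INR (2 * i + 1) / w ^ 2 * cosmom i w
  = (PI / 2) ^ (2 * i + 2) * (sin (w * (PI / 2)) / w).
Proof.
  intros Hw Hc.
  assert (HP := PI_RGT_0).
  set (F := fun v => v ^ (2 * i + 2) * sin (w * v) / w
    + INR (2 * i + 2) * v ^ (2 * i + 1) * cos (w * v) / w ^ 2).
  eapply is_RInt_Runique.
  { apply is_RInt_Rplus; [|apply is_RInt_Rscal]; apply is_RInt_cosmom. }
  replace (_ * (_ / w)) with (F (PI / 2) - F 0).
  - apply is_RInt_Rderive; [lra| |]; intros x _.
    + unfold F. auto_derive; [auto|].
      change (i + (i + 0))%nat with (2 * i)%nat.
      replace (Init.Nat.pred (2 * i + 2)) with (2 * i + 1)%nat by lia.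
      replace (Init.Nat.pred (2 * i + 1)) with (2 * i)%nat by lia.
      replace (2 * S i)%nat with (2 + 2 * i)%nat by lia.
      replace (2 * i + 2)%nat with (2 + 2 * i)%nat by lia.
      replace (2 * i + 1)%nat with (1 + 2 * i)%nat by lia.
      rewrite !pow_add. simpl (_ ^ 1); simpl (_ ^ 2). field; assumption.
    + apply (ex_derive_continuous (fun v => v ^ (2 * S i) * cos (w * v) +
        INR (2 * i + 2) * INR (2 * i + 1) / w ^ 2 * (v ^ (2 * i) * cos (w * v)))).
      auto_derive; auto.
  - unfold F. rewrite Hc, !(pow_ne_zero (2 * i + _)) by lia.
    field; assumption.
Qed.

Lemma cos_sin_odd_quarter (j : nat) :
  cos (INR (2 * j + 1) * (PI / 2)) = 0 /\ sin (INR (2 * j + 1) * (PI / 2)) = (-1) ^ j.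
Proof.
  induction j as [|j [IHc IHs]].
  - simpl. rewrite Rmult_1_l, cos_PI2, sin_PI2. auto.
  - replace (INR (2 * S j + 1) * (PI / 2)) with (INR (2 * j + 1) * (PI / 2) + PI).
    + rewrite neg_cos, neg_sin, IHc, IHs. simpl; split; ring.
    + replace (2 * S j + 1)%nat with (2 * j + 1 + 2)%nat by lia.
      rewrite (plus_INR _ 2). simpl (INR 2). field.
Qed.

Lemma INR_odd_neq_0 (j : nat) : INR (2 * j + 1) <> 0.
Proof. apply not_0_INR; lia. Qed.

(** Integration by parts lowers i and brings a factor w^(-2); with the weight w^(-2s) built in, the
    family is closed under the recurrence (i+1, s) -> (i, s+1). *)
Definition cosmom_term (i s j : nat) : R :=
  cosmom i (INR (2 * j + 1)) / INR (2 * j + 1) ^ (2 * s).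

Lemma cosmom_term_0 (s j : nat) :
  cosmom_term 0 s j = (-1) ^ j / INR (2 * j + 1) ^ S (2 * s).
Proof.
  unfold cosmom_term.
  assert (H := INR_odd_neq_0 j).
  rewrite cosmom_0, (proj2 (cos_sin_odd_quarter j)) by assumption.
  change (INR (2 * j + 1) ^ S (2 * s)) with (INR (2 * j + 1) * INR (2 * j + 1) ^ (2 * s)).
  field; split; [apply pow_nonzero|]; assumption.
Qed.

Lemma cosmom_term_S (i s j : nat) :
  cosmom_term (S i) s j =
  (PI / 2) ^ (2 * i + 2) * ((-1) ^ j / INR (2 * j + 1) ^ S (2 * s))
  + - (INR (2 * i + 2) * INR (2 * i + 1)) * cosmom_term i (S s) j.
Proof.
  unfold cosmom_term.
  assert (H := INR_odd_neq_0 j).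
  destruct (cos_sin_odd_quarter j) as [Hc Hs].
  assert (E := cosmom_S i _ H Hc). rewrite Hs in E.
  replace (2 * S s)%nat with (2 + 2 * s)%nat by lia.
  rewrite (pow_add (INR (2 * j + 1)) 2).
  replace (cosmom (S i) (INR (2 * j + 1))) with
    ((PI / 2) ^ (2 * i + 2) * ((-1) ^ j / INR (2 * j + 1)) -
     INR (2 * i + 2) * INR (2 * i + 1) / INR (2 * j + 1) ^ 2 * cosmom i (INR (2 * j + 1))).
  - change (INR (2 * j + 1) ^ S (2 * s)) with (INR (2 * j + 1) * INR (2 * j + 1) ^ (2 * s)).
    field; split; [apply pow_nonzero|]; assumption.
  - rewrite <- E; ring.
Qed.

Definition cosmom_sum (i s : nat) : R := Series (cosmom_term i s).

(** At s = 0 the terms are only of order 1/(2j+1) and convergence is not absolute; it is inherited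
    from the alternating beta series through the recurrence. *)
Lemma is_series_cosmom (i s : nat) : is_series (cosmom_term i s) (cosmom_sum i s).
Proof.
  apply Series_correct; revert s; induction i as [|i IH]; intros s.
  - exists (beta (S (2 * s))).
    apply is_series_Rext with (2 := is_series_beta (2 * s)).
    intros j; symmetry; apply cosmom_term_0.
  - destruct (IH (S s)) as [l Hl].
    eexists.
    eapply is_series_Rext; [intros j; symmetry; apply cosmom_term_S|].
    apply is_series_Rplus; apply is_series_Rscal; [apply is_series_beta|exact Hl].
Qed.

Lemma cosmom_sum_0 (s : nat) : cosmom_sum 0 s = beta (S (2 * s)).
Proof. apply Series_ext; intros j; apply cosmom_term_0. Qed.

Lemma cosmom_sum_S (i s : nat) :
  cosmom_sum (S i) s = (PI / 2) ^ (2 * i + 2) * beta (S (2 * s))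
  + - (INR (2 * i + 2) * INR (2 * i + 1)) * cosmom_sum i (S s).
Proof.
  apply is_series_unique.
  eapply is_series_Rext; [intros j; symmetry; apply cosmom_term_S|].
  apply is_series_Rplus; apply is_series_Rscal; [apply is_series_beta|apply is_series_cosmom].
Qed.

Definition odd_cos_sum (N : nat) (v : R) : R := sum_n (fun j => cos (INR (2 * j + 1) * v)) N.

(** 2 sin v cos((2j+1)v) = sin((2j+2)v) - sin(2jv), which telescopes. *)
Lemma odd_cos_sum_sin (N : nat) (v : R) :
  2 * sin v * odd_cos_sum N v = sin (2 * INR (S N) * v).
Proof.
  unfold odd_cos_sum; induction N as [|N IH].
  - rewrite sum_O. simpl INR. rewrite Rmult_1_l, Rmult_1_r, sin_2a. ring.
  - rewrite sum_Sn. unfold plus; cbn -[INR Nat.mul sum_n].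
    rewrite Rmult_plus_distr_l, IH.
    replace (2 * INR (S (S N)) * v) with (INR (2 * S N + 1) * v + v).
    2: { rewrite plus_INR, mult_INR, (S_INR (S N)). simpl (INR 2); simpl (INR 1); ring. }
    replace (2 * INR (S N) * v) with (INR (2 * S N + 1) * v - v).
    2: { rewrite plus_INR, mult_INR. simpl (INR 2); simpl (INR 1); ring. }
    rewrite sin_plus, sin_minus. ring.
Qed.

Lemma Rabs_odd_cos_sum_le (N : nat) (v : R) : Rabs (odd_cos_sum N v) <= INR (S N).
Proof.
  unfold odd_cos_sum; induction N as [|N IH].
  - rewrite sum_O. simpl INR. apply Rabs_le, COS_bound.
  - rewrite sum_Sn, S_INR.
    eapply Rle_trans; [apply Rabs_triang|].
    apply Rplus_le_compat; [exact IH|apply Rabs_le, COS_bound].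
Qed.

Lemma continuous_odd_cos_sum (N : nat) (v : R) : continuous (odd_cos_sum N) v.
Proof.
  unfold odd_cos_sum; induction N as [|N IH].
  - apply continuous_ext with (f := fun v => cos (INR (2 * 0 + 1) * v)).
    { intros x; now rewrite sum_O. }
    apply (ex_derive_continuous (fun v => cos (INR (2 * 0 + 1) * v))); auto_derive; auto.
  - apply continuous_ext with
      (f := fun v => sum_n (fun j => cos (INR (2 * j + 1) * v)) N + cos (INR (2 * S N + 1) * v)).
    { intros x; now rewrite sum_Sn. }
    apply continuous_Rplus; [exact IH|].
    apply (ex_derive_continuous (fun v => cos (INR (2 * S N + 1) * v))); auto_derive; auto.
Qed.

Lemma is_RInt_pow_odd_cos_sum (i N : nat) :
  is_RInt (fun v => v ^ (2 * i) * odd_cos_sum N v) 0 (PI / 2) (sum_n (cosmom_term i 0) N).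
Proof.
  assert (E : forall j, cosmom_term i 0 j = cosmom i (INR (2 * j + 1))).
  { intros j; unfold cosmom_term; simpl (_ ^ (2 * 0)); field. }
  unfold odd_cos_sum; induction N as [|N IH].
  - rewrite sum_O, E.
    eapply is_RInt_ext; [|apply is_RInt_cosmom].
    intros x _; now rewrite sum_O.
  - rewrite sum_Sn, E.
    eapply is_RInt_ext; [|apply is_RInt_Rplus; [exact IH|apply is_RInt_cosmom]].
    intros x _; rewrite sum_Sn. symmetry; apply Rmult_plus_distr_l.
Qed.

(** sin v >= v - v^3/6, and v^2 <= 4 because PI <= 4. *)
Lemma sin_ge_third (v : R) : 0 <= v <= PI / 2 -> v / 3 <= sin v.
Proof.
  intros [H0 H1]. assert (HP := PI_4).
  assert (HP0 := PI_RGT_0).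
  destruct (sin_bound v 0 H0 ltac:(lra)) as [H _].
  apply Rle_trans with (2 := H).
  unfold sin_approx, sin_term; simpl.
  assert (v * v <= 4) by nra.
  field_simplify; nra.
Qed.

Lemma Rabs_is_RInt_le (f : R -> R) (a b M l : R) :
  a <= b -> (forall x, a <= x <= b -> Rabs (f x) <= M) -> is_RInt f a b l ->
  Rabs l <= (b - a) * M.
Proof.
  intros Hab Hf Hl.
  exact (@norm_RInt_le R_NormedModule f (fun _ => M) a b l ((b - a) * M) Hab Hf Hl
    (is_RInt_Rconst a b M)).
Qed.

(** A Riemann-Lebesgue estimate with a rate. One integration by parts of v^(2i+2) sin(2kv) / (2 sin
    v), with k = N+1, gains 1/k. The power of v, at least 2, absorbs the singularity 1/sin^2 v that
    differentiation creates, so the bound does not depend on d. The leading 4 counts two boundary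
    values and an integral over a length of at most 2. *)
Lemma oscillatory_tail_le (i N : nat) (d l : R) :
  0 < d <= PI / 2 ->
  is_RInt (fun v => v ^ (2 * S i) * odd_cos_sum N v) d (PI / 2) l ->
  Rabs l <= 4 * (9 * INR (2 * i + 3) * 4 ^ S i) / INR (S N).
Proof.
  intros Hd Hl.
  assert (HP := PI_4).
  set (k := INR (S N)).
  assert (Hk : 0 < k) by (apply lt_0_INR; lia).
  set (n := INR (2 * i + 2)).
  assert (Hn : 1 <= n) by (apply (le_INR 1); lia).
  (* The 9 comes from squaring sin v >= v/3, the factor 2i+3 from differentiating v^(2i+2) / sin v,
     and 4^(i+1) generously covers the powers of v <= 2. *)
  set (C := 9 * INR (2 * i + 3) * 4 ^ S i).
  assert (En : INR (2 * i + 3) = n + 1).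
  { unfold n; rewrite <- S_INR; f_equal; lia. }
  assert (Hsin : forall v, d <= v <= PI / 2 -> 0 < v <= 2 /\ v / 3 <= sin v <= v).
  { intros v Hv; repeat split; try lra.
    - apply sin_ge_third; lra.
    - apply Rlt_le, sin_lt_x; lra. }
  assert (H4 : forall v, 0 < v <= 2 -> 0 < v ^ (2 * i) <= 4 ^ i).
  { intros v Hv; split; [apply pow_lt; lra|].
    rewrite pow_mult; apply pow_incr; split; [apply pow2_ge_0|nra]. }
  assert (Hi : 0 < 4 ^ i) by (apply pow_lt; lra).
  assert (HC : C = 36 * (n + 1) * 4 ^ i) by (unfold C; rewrite En; simpl; ring).
  (* With a(v) = v^(2i+2) / (2 sin v), [E] is -a cos(2kv)/(2k) and [rho] is a' cos(2kv)/(2k), so E'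
     = a sin(2kv) - rho. *)
  set (E := fun v => - (v ^ (2 * i + 2) * cos (2 * k * v) / (4 * k * sin v))).
  set (rho := fun v => (n * v ^ (2 * i + 1) * sin v - v ^ (2 * i + 2) * cos v)
     / (sin v) ^ 2 * (cos (2 * k * v) / (4 * k))).
  assert (Hcos : forall x, Rabs (cos x) <= 1) by (intros x; apply Rabs_le, COS_bound).
  assert (HE : forall v, d <= v <= PI / 2 -> Rabs (E v) <= C / k).
  { intros v Hv; destruct (Hsin v Hv) as [Hv2 Hs].
    unfold E. rewrite Rabs_Ropp. unfold Rdiv.
    rewrite !Rabs_mult, Rabs_inv, (Rabs_pos_eq (v ^ _)), (Rabs_pos_eq (4 * k * sin v)).
    2: nra. 2: apply pow_le; lra.
    apply Rle_trans with (v ^ (2 * i + 2) * 1 * / (4 * k * (v / 3))).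
    - apply Rmult_le_compat.
      + apply Rmult_le_pos; [apply pow_le; lra|apply Rabs_pos].
      + left; apply Rinv_0_lt_compat; nra.
      + apply Rmult_le_compat_l; [apply pow_le; lra|apply Hcos].
      + apply Rinv_le_contravar; nra.
    - rewrite pow_add, HC.
      replace (v ^ (2 * i) * v ^ 2 * 1 * / (4 * k * (v / 3)))
        with (3 * v / 4 * v ^ (2 * i) * / k) by (field; lra).
      apply Rmult_le_compat_r; [left; now apply Rinv_0_lt_compat|].
      specialize (H4 v Hv2). nra. }
  assert (Hrho : forall v, d <= v <= PI / 2 -> Rabs (rho v) <= C / k).
  { intros v Hv; destruct (Hsin v Hv) as [Hv2 Hs].
    unfold rho, Rdiv.
    rewrite !Rabs_mult, !Rabs_inv, (Rabs_pos_eq (4 * k)) by lra.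
    rewrite (Rabs_pos_eq (sin v ^ 2)) by apply pow2_ge_0.
    specialize (H4 v Hv2).
    assert (Hnum : Rabs (n * v ^ (2 * i + 1) * sin v - v ^ (2 * i + 2) * cos v)
      <= (n + 1) * (v ^ (2 * i) * v ^ 2)).
    { eapply Rle_trans; [apply Rabs_triang|].
      rewrite Rabs_Ropp, !Rabs_mult, (Rabs_pos_eq n), (Rabs_pos_eq (v ^ (2 * i + 1))),
        (Rabs_pos_eq (v ^ (2 * i + 2))), (Rabs_pos_eq (sin v)).
      2-5: try (apply pow_le); lra.
      rewrite !pow_add. simpl (v ^ 1); simpl (v ^ 2).
      specialize (Hcos v).
      assert (A1 : n * (v ^ (2 * i) * (v * 1)) * sin v <= n * (v ^ (2 * i) * (v * 1)) * v).
      { apply Rmult_le_compat_l; [|lra].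
        repeat apply Rmult_le_pos; lra. }
      assert (A2 : v ^ (2 * i) * (v * (v * 1)) * Rabs (cos v) <= v ^ (2 * i) * (v * (v * 1)) * 1).
      { apply Rmult_le_compat_l; [|lra].
        repeat apply Rmult_le_pos; lra. }
      lra. }
    apply Rle_trans with ((n + 1) * (v ^ (2 * i) * v ^ 2) * / (v / 3) ^ 2 * (1 * / (4 * k))).
    - apply Rmult_le_compat.
      + apply Rmult_le_pos; [apply Rabs_pos|].
        left; apply Rinv_0_lt_compat, pow_lt; lra.
      + apply Rmult_le_pos; [apply Rabs_pos|].
        left; apply Rinv_0_lt_compat; lra.
      + apply Rmult_le_compat; [apply Rabs_pos| |exact Hnum|].
        * left; apply Rinv_0_lt_compat, pow_lt; lra.
        * apply Rinv_le_contravar; [apply pow_lt; lra|apply pow_incr; lra].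
      + apply Rmult_le_compat_r; [left; apply Rinv_0_lt_compat; lra|apply Hcos].
    - rewrite HC.
      replace ((n + 1) * (v ^ (2 * i) * v ^ 2) * / (v / 3) ^ 2 * (1 * / (4 * k)))
        with (9 / 4 * (n + 1) * v ^ (2 * i) * / k) by (field; lra).
      apply Rmult_le_compat_r; [left; now apply Rinv_0_lt_compat|].
      nra. }
  assert (Hc0 : forall v, d <= v <= PI / 2 -> continuous rho v).
  { intros v Hv; destruct (Hsin v Hv) as [Hv2 Hs].
    apply (ex_derive_continuous rho). unfold rho. auto_derive.
    repeat split; auto; nra. }
  assert (Hcf : forall v, continuous (fun v => v ^ (2 * S i) * odd_cos_sum N v) v).
  { intros v. apply (continuous_mult (fun v => v ^ (2 * S i))).
    - apply (ex_derive_continuous (fun v => v ^ (2 * S i))). auto_derive; auto.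
    - apply continuous_odd_cos_sum. }
  assert (HI : is_RInt (fun v => v ^ (2 * S i) * odd_cos_sum N v - rho v) d (PI / 2)
    (E (PI / 2) - E d)).
  { apply is_RInt_Rderive; [lra| |].
    - intros v Hv; destruct (Hsin v Hv) as [Hv2 Hs].
      assert (HD := odd_cos_sum_sin N v); fold k in HD.
      assert (ED : odd_cos_sum N v = sin (2 * k * v) / (2 * sin v)).
      { rewrite <- HD; field; lra. }
      rewrite ED. unfold E, rho. auto_derive; [nra|].
      change (i + (i + 0))%nat with (2 * i)%nat.
      replace (Init.Nat.pred (2 * i + 2)) with (2 * i + 1)%nat by lia.
      fold n.
      replace (2 * S i)%nat with (2 * i + 2)%nat by lia.
      rewrite !pow_add.
      field; lra.
    - intros v Hv.
      apply (@continuous_minus R_UniformSpace R_AbsRing R_NormedModule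
        (fun v => v ^ (2 * S i) * odd_cos_sum N v) rho); auto. }
  assert (Hr : is_RInt rho d (PI / 2) (RInt rho d (PI / 2))).
  { apply (@RInt_correct R_CompleteNormedModule).
    apply (@ex_RInt_continuous R_CompleteNormedModule); intros z Hz.
    rewrite Rmin_left, Rmax_right in Hz by lra. auto. }
  assert (EL : l = E (PI / 2) - E d + RInt rho d (PI / 2)).
  { eapply is_RInt_Runique; [exact Hl|].
    eapply is_RInt_ext; [|apply is_RInt_Rplus; [exact HI|exact Hr]].
    intros v _. change (v ^ (2 * S i) * odd_cos_sum N v - rho v + rho v =
      v ^ (2 * S i) * odd_cos_sum N v); ring. }
  apply Rabs_is_RInt_le with (M := C / k) in Hr; [|lra|assumption].
  assert (B1 := HE (PI / 2) ltac:(lra)). assert (B2 := HE d ltac:(lra)).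
  assert (HCk : 0 <= C / k) by (eapply Rle_trans; [apply Rabs_pos|apply B1]).
  rewrite EL.
  replace (4 * C / k) with (C / k + C / k + 2 * (C / k)) by (field; lra).
  eapply Rle_trans; [apply Rabs_triang|].
  apply Rplus_le_compat.
  - eapply Rle_trans; [apply Rabs_triang|]. rewrite Rabs_Ropp; lra.
  - apply Rle_trans with (1 := Hr). apply Rmult_le_compat_r; lra.
Qed.

(** Since the tail bound is uniform in d, the piece [0,d] can be made smaller than any eps; there
    the integrand is at most A by the crude bound N+1 on the kernel. *)
Lemma Rabs_sum_cosmom_le (i N : nat) :
  Rabs (sum_n (cosmom_term (S i) 0) N) <= 4 * (9 * INR (2 * i + 3) * 4 ^ S i) / INR (S N).
Proof.
  assert (HP := PI_4). assert (HP0 := PI2_1).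
  set (A := 4 ^ S i * INR (S N)).
  assert (HA : 0 < A).
  { apply Rmult_lt_0_compat; [apply pow_lt; lra|apply lt_0_INR; lia]. }
  assert (HI := is_RInt_pow_odd_cos_sum (S i) N).
  apply le_epsilon; intros eps Heps.
  set (d := Rmin 1 (eps / A)).
  assert (Hd : 0 < d <= 1).
  { split; [apply Rmin_glb_lt; [lra|now apply Rdiv_lt_0_compat]|apply Rmin_l]. }
  assert (HdA : d * A <= eps).
  { apply Rle_trans with (eps / A * A); [|right; field; lra].
    apply Rmult_le_compat_r; [lra|apply Rmin_r]. }
  assert (X : ex_RInt (fun v => v ^ (2 * S i) * odd_cos_sum N v) 0 (PI / 2))
    by (eexists; exact HI).
  assert (X1 := ex_RInt_Chasles_1 _ 0 d (PI / 2) ltac:(lra) X).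
  assert (X2 := ex_RInt_Chasles_2 _ 0 d (PI / 2) ltac:(lra) X).
  destruct X1 as [l1 X1]. destruct X2 as [l2 X2].
  assert (EL : sum_n (cosmom_term (S i) 0) N = l1 + l2).
  { eapply is_RInt_Runique; [exact HI|].
    exact (@is_RInt_Chasles R_NormedModule _ 0 d (PI / 2) l1 l2 X1 X2). }
  rewrite EL.
  eapply Rle_trans; [apply Rabs_triang|].
  rewrite (Rplus_comm (Rabs l1)). apply Rplus_le_compat.
  - apply (oscillatory_tail_le i N d); [lra|exact X2].
  - apply Rle_trans with (2 := HdA).
    rewrite <- (Rminus_0_r d).
    apply (Rabs_is_RInt_le _ 0 d A l1) in X1; [exact X1|lra|].
    intros x Hx. unfold A. rewrite Rabs_mult.
    apply Rmult_le_compat; try apply Rabs_pos; [|apply Rabs_odd_cos_sum_le].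
    rewrite Rabs_pos_eq by (apply pow_le; lra).
    rewrite pow_mult. apply pow_incr; split; [apply pow2_ge_0|nra].
Qed.

Lemma cosmom_sum_S_0 (i : nat) : cosmom_sum (S i) 0 = 0.
Proof.
  assert (H := is_series_cosmom (S i) 0).
  assert (L : is_lim_seq (sum_n (cosmom_term (S i) 0)) 0).
  { apply is_lim_seq_abs_0.
    apply is_lim_seq_le_le with (u := fun _ => 0)
      (w := fun N => 4 * (9 * INR (2 * i + 3) * 4 ^ S i) * / INR (1 * N + 1)).
    - intros N; split; [apply Rabs_pos|].
      replace (1 * N + 1)%nat with (S N) by lia.
      apply Rabs_sum_cosmom_le.
    - apply is_lim_seq_const.
    - rewrite <- (Rmult_0_r (4 * (9 * INR (2 * i + 3) * 4 ^ S i))).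
      apply (is_lim_seq_scal_l _ _ 0), is_lim_seq_inv_INR_affine; lia. }
  apply is_series_unique_R with (1 := H) (2 := L).
Qed.

(* Descends along [i + s = n] from [cosmom_sum n 0 = 0] to [cosmom_sum 0 n = beta (2 n + 1)]. *)
Lemma beta_odd_rational_PI (n : nat) :
  exists a, rational a /\ beta (S (2 * n)) = a * PI ^ S (2 * n).
Proof.
  induction n as [n IHn] using (well_founded_induction Nat.lt_wf_0).
  destruct n as [|n].
  { exists (/ 4); split; [auto with rational|].
    simpl (2 * 0)%nat. rewrite beta_1. simpl; field. }
  assert (H : forall s, (s <= S n)%nat -> exists a, rational a /\
    cosmom_sum (S n - s) s = a * PI ^ S (2 * S n)).
  { induction s as [|s IHs]; intros Hs.
    - exists 0; split; [auto with rational|].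
      rewrite Nat.sub_0_r, cosmom_sum_S_0; ring.
    - destruct IHs as [a [Ha Ea]]; [lia|].
      destruct (IHn s) as [b [Hb Eb]]; [lia|].
      replace (S n - s)%nat with (S (S n - S s)) in Ea by lia.
      rewrite cosmom_sum_S, Eb in Ea.
      set (i := (S n - S s)%nat) in *.
      assert (N1 : INR (2 * i + 2) <> 0) by (apply not_0_INR; lia).
      assert (N2 : INR (2 * i + 1) <> 0) by (apply not_0_INR; lia).
      exists (((/ 2) ^ (2 * i + 2) * b - a) / (INR (2 * i + 2) * INR (2 * i + 1))).
      split; [auto 10 with rational|].
      (* Homogeneity in PI: i + s = n gives (2i+2) + (2s+1) = 2(n+1) + 1. *)
      assert (EP : (PI / 2) ^ (2 * i + 2) * (b * PI ^ S (2 * s)) =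
        (/ 2) ^ (2 * i + 2) * b * PI ^ S (2 * S n)).
      { unfold Rdiv; rewrite Rpow_mult_distr.
        replace (S (2 * S n)) with ((2 * i + 2) + S (2 * s))%nat by lia.
        rewrite (pow_add PI (2 * i + 2)). ring. }
      rewrite EP in Ea.
      replace (cosmom_sum i (S s)) with
       (((/ 2) ^ (2 * i + 2) * b * PI ^ S (2 * S n) - a * PI ^ S (2 * S n))
        / (INR (2 * i + 2) * INR (2 * i + 1))).
      + field; auto.
      + rewrite <- Ea. field; auto. }
  destruct (H (S n) (le_n _)) as [a [Ha Ea]].
  rewrite Nat.sub_diag, cosmom_sum_0 in Ea.
  now exists a.
Qed.

(** * Series of inverse powers and zeta values *)

Lemma is_series_telescope (u : nat -> R) (l : R) :
  is_lim_seq u l -> is_series (fun k => u k - u (S k)) (u 0%nat - l).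
Proof.
  intros Hu.
  change (is_lim_seq (sum_n (fun k => u k - u (S k))) (u 0%nat - l)).
  apply is_lim_seq_ext with (u := fun n => u 0%nat - u (S n)).
  - intros n; induction n as [|n IH]; [now rewrite sum_O|].
    rewrite sum_Sn, <- IH. unfold plus; simpl; ring.
  - apply is_lim_seq_minus'; [apply is_lim_seq_const|].
    now apply is_lim_seq_incr_1 in Hu.
Qed.

Lemma is_lim_seq_inv_shift (a : R) : is_lim_seq (fun k => / (a + INR k)) 0.
Proof.
  change (Finite 0) with (Rbar_inv p_infty).
  apply is_lim_seq_inv; [|discriminate].
  apply is_lim_seq_plus with (l1 := a) (l2 := p_infty).
  - apply is_lim_seq_const.
  - apply is_lim_seq_INR.
  - reflexivity.
Qed.

(** 1/(a+k+1)^2 is at most the telescoping difference 1/(a+k) - 1/(a+k+1), and the other powers are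
    bounded by a^(-m). It serves zeta with a = 1, and later the Hurwitz sums and their majorants. *)
Lemma ex_series_inv_shift_pow (a : R) (m : nat) :
  0 < a -> ex_series (fun k => / (a + INR k) ^ S (S m)).
Proof.
  intros Ha.
  assert (H2 : ex_series (fun k => (/ a) ^ m * / (a + INR k) ^ 2)).
  { apply (ex_series_scal ((/ a) ^ m) (fun k => / (a + INR k) ^ 2)).
    apply ex_series_incr_1.
    apply (@ex_series_le R_AbsRing R_CompleteNormedModule) with
      (b := fun k => / (a + INR k) - / (a + INR (S k))).
    - intros k. change (Rabs (/ (a + INR (S k)) ^ 2) <= / (a + INR k) - / (a + INR (S k))).
      assert (Hk := pos_INR k).
      rewrite S_INR, Rabs_pos_eq by (left; apply Rinv_0_lt_compat, pow_lt; lra).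
      replace (/ (a + INR k) - / (a + (INR k + 1))) with (/ ((a + INR k) * (a + (INR k + 1))))
        by (field; lra).
      apply Rinv_le_contravar; nra.
    - eexists. apply (is_series_telescope (fun k => / (a + INR k))), is_lim_seq_inv_shift. }
  revert H2.
  apply (@ex_series_le R_AbsRing R_CompleteNormedModule).
  intros k. change (Rabs (/ (a + INR k) ^ S (S m)) <= (/ a) ^ m * / (a + INR k) ^ 2).
  assert (Hk := pos_INR k).
  rewrite Rabs_pos_eq by (left; apply Rinv_0_lt_compat, pow_lt; lra).
  change (S (S m)) with (2 + m)%nat.
  rewrite pow_add, Rinv_mult, Rmult_comm.
  apply Rmult_le_compat_r; [left; apply Rinv_0_lt_compat, pow_lt; lra|].
  rewrite pow_inv. apply Rinv_le_contravar; [now apply pow_lt|].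
  apply pow_incr; lra.
Qed.

Lemma is_series_zeta (p : nat) :
  is_series (fun n => / INR (n + 1) ^ S (S p)) (zeta (INR (S p + 1))).
Proof.
  unfold zeta.
  apply is_series_Rext with (a := fun n => / Rpower (INR (n + 1)) (INR (S p + 1))).
  { intros n. rewrite Rpower_pow by (apply lt_0_INR; lia). do 2 f_equal; lia. }
  apply Series_correct.
  apply ex_series_ext with (2 := ex_series_inv_shift_pow 1 p Rlt_0_1).
  intros n. rewrite Rpower_pow by (apply lt_0_INR; lia).
  rewrite plus_INR, Rplus_comm. change (INR 1) with 1.
  do 2 f_equal; lia.
Qed.

(** With s = p+2, the alternating zeta value is (1 - 2^(1-s)) zeta(s); the other factor 2^(-s) comes
    from the even denominators 2(j+1). *)
Lemma lnint_1_zeta (p : nat) :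
  lnint 1 (S p) 1 = (-1) ^ S p * INR (Factorial.fact (S p)) / 2 ^ S (S p)
    * (1 - 2 / 2 ^ S (S p)) * zeta (INR (S p + 1)).
Proof.
  set (s := S (S p)).
  assert (Hf : INR (Factorial.fact (S p)) <> 0) by apply INR_fact_neq_0.
  assert (H2 : 2 ^ s <> 0) by (apply pow_nonzero; lra).
  assert (H1 := pow_m1_sqr (S p)).
  assert (Hz := is_series_zeta p). fold s in Hz.
  assert (He : is_series (fun j => (-1) ^ j * / INR (j + 1) ^ s)
    (2 ^ s * ((-1) ^ S p / INR (Factorial.fact (S p)) * lnint 1 (S p) 1))).
  { assert (H := is_series_Rscal _ (2 ^ s) _ (is_series_lnint 0 (S p))).
    revert H; apply is_series_Rext; intros j. fold s.
    replace (0 + 2 + 2 * j)%nat with (2 * (j + 1))%nat by lia.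
    rewrite mult_INR, Rpow_mult_distr. change (INR 2) with 2.
    field. split; [|assumption]. apply pow_nonzero, not_0_INR; lia. }
  set (z := fun n => / INR (n + 1) ^ s) in *.
  (* Flipping the signs at odd indices subtracts those terms twice, and they are 2^(-s) times the
     terms [z 0], ..., [z N]. *)
  assert (E : forall N, sum_n (fun j => (-1) ^ j * z j) (2 * N + 1) =
    sum_n z (2 * N + 1) - 2 / 2 ^ s * sum_n z N).
  { assert (Ez : forall N, z (2 * N + 1)%nat = / 2 ^ s * z N).
    { intros N. unfold z. replace (2 * N + 1 + 1)%nat with (2 * (N + 1))%nat by lia.
      rewrite mult_INR, Rpow_mult_distr, Rinv_mult. reflexivity. }
    assert (Ee : forall N, (-1) ^ (2 * N) = 1) by apply pow_1_even.
    assert (Eo : forall N, (-1) ^ (2 * N + 1) = -1).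
    { intros N; rewrite pow_add, Ee; ring. }
    induction N as [|N IH].
    - change (2 * 0 + 1)%nat with 1%nat. rewrite !sum_Sn, !sum_O.
      assert (Z1 := Ez 0%nat). change (2 * 0 + 1)%nat with 1%nat in Z1.
      change ((-1) ^ 0 * z 0%nat + (-1) ^ 1 * z 1%nat =
        z 0%nat + z 1%nat - 2 / 2 ^ s * z 0%nat).
      rewrite Z1. field; assumption.
    - replace (2 * S N + 1)%nat with (S (S (2 * N + 1))) by lia.
      rewrite (sum_Sn _ (S (2 * N + 1))), (sum_Sn _ (2 * N + 1)), IH,
        (sum_Sn z (S (2 * N + 1))), (sum_Sn z (2 * N + 1)), (sum_Sn z N).
      replace (S (S (2 * N + 1))) with (2 * S N + 1)%nat by lia.
      replace (S (2 * N + 1)) with (2 * S N)%nat by lia.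
      rewrite Eo, Ee, Ez. unfold plus; cbn -[z Nat.mul sum_n Nat.add pow]. field; assumption. }
  assert (Hphi : filterlim (fun N => (2 * N + 1)%nat) eventually eventually).
  { apply eventually_subseq; intros N; lia. }
  assert (L1 : is_lim_seq (fun N => sum_n (fun j => (-1) ^ j * z j) (2 * N + 1))
    (2 ^ s * ((-1) ^ S p / INR (Factorial.fact (S p)) * lnint 1 (S p) 1))).
  { apply (is_lim_seq_subseq (sum_n (fun j => (-1) ^ j * z j)) _ _ Hphi). exact He. }
  assert (L2 : is_lim_seq (fun N => sum_n (fun j => (-1) ^ j * z j) (2 * N + 1))
    (zeta (INR (S p + 1)) - 2 / 2 ^ s * zeta (INR (S p + 1)))).
  { eapply is_lim_seq_ext; [intros N; symmetry; apply E|].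
    apply is_lim_seq_minus'.
    - apply (is_lim_seq_subseq (sum_n z) _ _ Hphi). exact Hz.
    - apply (is_lim_seq_scal_l (sum_n z) (2 / 2 ^ s) (zeta (INR (S p + 1)))). exact Hz. }
  apply is_lim_seq_unique in L1, L2. rewrite L1 in L2. apply Rbar_finite_eq in L2.
  transitivity ((-1) ^ S p * (-1) ^ S p * lnint 1 (S p) 1); [rewrite H1; ring|].
  replace ((-1) ^ S p * (-1) ^ S p * lnint 1 (S p) 1) with
    ((-1) ^ S p * INR (Factorial.fact (S p)) / 2 ^ s *
     (2 ^ s * ((-1) ^ S p / INR (Factorial.fact (S p)) * lnint 1 (S p) 1)))
    by (field; auto).
  rewrite L2. field; assumption.
Qed.

(** * Termwise differentiation and the Gamma function *)

Lemma is_series_le (a b : nat -> R) (x y : R) :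
  (forall n, a n <= b n) -> is_series a x -> is_series b y -> x <= y.
Proof.
  intros H Ha Hb.
  change (Rbar_le x y).
  apply is_lim_seq_le with (2 := Ha) (3 := Hb).
  intros n. apply sum_n_m_le; assumption.
Qed.

(** The mean value theorem for f, then for f' between x and the intermediate point; the factor 1/2
    of Taylor's formula is given up. *)
Lemma second_order_remainder_le (f df ddf : R -> R) (x d c y : R) :
  (forall t, Rabs (t - x) < d -> is_derive f t (df t)) ->
  (forall t, Rabs (t - x) < d -> is_derive df t (ddf t)) ->
  (forall t, Rabs (t - x) < d -> Rabs (ddf t) <= c) ->
  Rabs (y - x) < d ->
  Rabs (f y - f x - df x * (y - x)) <= c * (y - x) ^ 2.
Proof.
  intros Hf Hdf Hc Hy.
  assert (Hin : forall z t, Rabs (z - x) < d -> Rmin x z <= t <= Rmax x z ->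
    Rabs (t - x) <= Rabs (z - x) /\ Rabs (t - x) < d).
  { intros z t Hz Ht.
    assert (Rabs (t - x) <= Rabs (z - x)); [|lra].
    revert Ht; unfold Rmin, Rmax; destruct (Rle_dec x z); intros Ht;
      unfold Rabs; destruct (Rcase_abs (t - x)), (Rcase_abs (z - x)); lra. }
  destruct (MVT_gen f x y df) as [xi [Hxi E]].
  { intros t Ht; apply Hf, (Hin y); lra. }
  { intros t Ht. apply continuity_pt_filterlim, (ex_derive_continuous f).
    eexists; apply Hf, (Hin y); lra. }
  destruct (Hin y xi Hy Hxi) as [Hxi1 Hxi2].
  destruct (MVT_gen df x xi ddf) as [eta [Heta E2]].
  { intros t Ht; apply Hdf, (Hin xi); lra. }
  { intros t Ht. apply continuity_pt_filterlim, (ex_derive_continuous df).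
    eexists; apply Hdf, (Hin xi); lra. }
  destruct (Hin xi eta Hxi2 Heta) as [_ Heta2].
  replace (f y - f x - df x * (y - x)) with (ddf eta * (xi - x) * (y - x))
    by (rewrite E, <- E2; ring).
  rewrite <- pow2_abs, !Rabs_mult.
  replace (c * Rabs (y - x) ^ 2) with (c * Rabs (y - x) * Rabs (y - x)) by ring.
  apply Rmult_le_compat_r; [apply Rabs_pos|].
  apply Rmult_le_compat; auto using Rabs_pos.
Qed.

(** Summing the remainders gives |F(y) - F(x) - D(y-x)| <= C (y-x)^2. Uniformity is asked only of
    the second derivatives, for which inverse powers have an obvious summable majorant; the first
    derivatives are summed at x alone. *)
Lemma is_derive_series (phi dphi ddphi : nat -> R -> R) (c : nat -> R) (F : R -> R) (x d D : R) :
  0 < d ->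
  (forall k t, Rabs (t - x) < d -> is_derive (phi k) t (dphi k t)) ->
  (forall k t, Rabs (t - x) < d -> is_derive (dphi k) t (ddphi k t)) ->
  (forall k t, Rabs (t - x) < d -> Rabs (ddphi k t) <= c k) ->
  ex_series c ->
  (forall t, Rabs (t - x) < d -> is_series (fun k => phi k t) (F t)) ->
  is_series (fun k => dphi k x) D ->
  is_derive F x D.
Proof.
  intros Hd Hphi Hdphi Hc [C HC] HF HD.
  assert (H0 : Rabs (x - x) < d) by (rewrite Rminus_diag, Rabs_R0; assumption).
  assert (HCpos : 0 <= C).
  { assert (Z : is_series (fun _ : nat => 0) (0 * C)).
    { apply is_series_Rext with (a := fun n => 0 * c n); [intros; ring|].
      now apply is_series_Rscal. }
    rewrite Rmult_0_l in Z.
    apply is_series_le with (2 := Z) (3 := HC).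
    intros k; eapply Rle_trans; [apply Rabs_pos|apply (Hc k x H0)]. }
  assert (HQ : forall y, Rabs (y - x) < d ->
    Rabs (F y - F x - D * (y - x)) <= C * (y - x) ^ 2).
  { intros y Hy.
    assert (HS : is_series (fun k => phi k y - phi k x - dphi k x * (y - x))
      (F y - F x - D * (y - x))).
    { replace (F y - F x - D * (y - x)) with (F y + -1 * F x + - (y - x) * D) by ring.
      apply is_series_Rext with
        (a := fun k => phi k y + -1 * phi k x + - (y - x) * dphi k x); [intros k; ring|].
      apply is_series_Rplus; [apply is_series_Rplus|].
      - now apply HF.
      - now apply is_series_Rscal, HF.
      - now apply is_series_Rscal. }
    assert (HB : forall k, Rabs (phi k y - phi k x - dphi k x * (y - x)) <= (y - x) ^ 2 * c k).
    { intros k; rewrite (Rmult_comm _ (c k)).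
      apply (second_order_remainder_le _ _ (ddphi k) _ d); auto. }
    apply Rabs_le; split.
    - apply is_series_le with (a := fun k => - (y - x) ^ 2 * c k) (3 := HS).
      + intros k. specialize (HB k). apply Rabs_le_between in HB. lra.
      + replace (- (C * (y - x) ^ 2)) with (- (y - x) ^ 2 * C) by ring.
        now apply is_series_Rscal.
    - apply is_series_le with (b := fun k => (y - x) ^ 2 * c k) (2 := HS).
      + intros k. specialize (HB k). apply Rabs_le_between in HB. lra.
      + rewrite Rmult_comm. now apply is_series_Rscal. }
  apply is_derive_Reals; intros eps Heps.
  assert (Hm : 0 < Rmin d (eps / (C + 1))).
  { apply Rmin_glb_lt; [assumption|apply Rdiv_lt_0_compat; lra]. }
  exists (mkposreal _ Hm); intros h Hh Hhd; simpl in Hhd.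
  assert (M1 := Rmin_l d (eps / (C + 1))). assert (M2 := Rmin_r d (eps / (C + 1))).
  assert (Hq := HQ (x + h)). replace (x + h - x) with h in Hq by ring.
  specialize (Hq ltac:(lra)).
  assert (Hhp : 0 < Rabs h) by now apply Rabs_pos_lt.
  replace ((F (x + h) - F x) / h - D) with ((F (x + h) - F x - D * h) / h) by (field; assumption).
  unfold Rdiv; rewrite Rabs_mult, Rabs_inv.
  apply Rle_lt_trans with (C * h ^ 2 * / Rabs h).
  - apply Rmult_le_compat_r; [left; now apply Rinv_0_lt_compat|assumption].
  - rewrite <- pow2_abs.
    replace (C * Rabs h ^ 2 * / Rabs h) with (C * Rabs h) by (field; lra).
    apply Rle_lt_trans with ((C + 1) * Rabs h); [nra|].
    apply Rlt_le_trans with ((C + 1) * (eps / (C + 1))).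
    + apply Rmult_lt_compat_l; lra.
    + right; field; lra.
Qed.

Lemma ln_diff_le (a b : R) : 0 < a -> 0 < b -> ln b - ln a <= (b - a) / a.
Proof.
  intros Ha Hb.
  assert (H := exp_ineq1_le (ln b - ln a)).
  unfold Rminus in H; rewrite exp_plus, exp_Ropp, !exp_ln in H by assumption.
  replace ((b - a) / a) with (b * / a - 1) by (field; lra). lra.
Qed.

Definition gamma_integrand (x t : R) : R := Rpower t (x - 1) * exp (- t).

Lemma gamma_integrand_pos (x t : R) : 0 < gamma_integrand x t.
Proof. apply Rmult_lt_0_compat; apply exp_pos. Qed.

Lemma continuous_gamma_integrand (x t : R) : 0 < t -> continuous (gamma_integrand x) t.
Proof.
  intros Ht. apply (ex_derive_continuous (gamma_integrand x)).
  unfold gamma_integrand, Rpower. auto_derive; assumption.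
Qed.

Lemma is_RInt_gamma_integrand (x a b : R) :
  0 < a -> a <= b -> is_RInt (gamma_integrand x) a b (RInt (gamma_integrand x) a b).
Proof.
  intros Ha Hab.
  apply (@RInt_correct R_CompleteNormedModule).
  apply (@ex_RInt_continuous R_CompleteNormedModule); intros z Hz.
  rewrite Rmin_left in Hz by lra. apply continuous_gamma_integrand; lra.
Qed.

Lemma RInt_gamma_integrand_mono (x a a' b' b : R) :
  0 < a -> a <= a' -> a' <= b' -> b' <= b ->
  RInt (gamma_integrand x) a' b' <= RInt (gamma_integrand x) a b.
Proof.
  intros Ha H1 H2 H3.
  assert (P : forall u v, 0 < u -> u <= v -> 0 <= RInt (gamma_integrand x) u v).
  { intros u v Hu Huv.
    assert (Z := is_RInt_Rconst u v 0); rewrite Rmult_0_r in Z.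
    apply is_RInt_le with (2 := Z) (3 := is_RInt_gamma_integrand x u v Hu Huv); [assumption|].
    intros t _; left; apply gamma_integrand_pos. }
  assert (E : RInt (gamma_integrand x) a b =
    RInt (gamma_integrand x) a a' + (RInt (gamma_integrand x) a' b' + RInt (gamma_integrand x) b' b)).
  { eapply is_RInt_Runique; [apply is_RInt_gamma_integrand; lra|].
    apply (@is_RInt_Chasles R_NormedModule _ a a' b); [apply is_RInt_gamma_integrand; lra|].
    apply (@is_RInt_Chasles R_NormedModule _ a' b' b); apply is_RInt_gamma_integrand; lra. }
  rewrite E.
  assert (P1 := P a a' ltac:(lra) ltac:(lra)). assert (P2 := P b' b ltac:(lra) ltac:(lra)).
  lra.
Qed.

(** For a natural N > x, 1 + t^x <= 2 (1+t)^N and (1+t)^(2N) <= (2N)! exp(1+t). The square is used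
    both to dominate the Gamma integrand and to make the boundary term t^x exp(-t) of order
    t^(-x). *)
Lemma Rpower_sqr_le_exp (x : R) :
  0 < x -> exists c, 0 < c /\ forall t, 0 < t -> (1 + Rpower t x) ^ 2 <= c * exp t.
Proof.
  intros Hx.
  destruct (INR_unbounded x) as [N HN].
  set (c := 4 * INR (Factorial.fact (2 * N)) * exp 1).
  assert (Hf := INR_fact_lt_0 (2 * N)).
  exists c; split.
  { assert (E := exp_pos 1). unfold c; nra. }
  intros t Ht.
  assert (H1 : Rpower t x <= (1 + t) ^ N).
  { rewrite <- Rpower_pow by lra.
    apply Rle_trans with (Rpower (1 + t) x).
    - apply Rle_Rpower_l; lra.
    - apply Rle_Rpower; lra. }
  assert (H2 : 1 <= (1 + t) ^ N) by (apply pow_R1_Rle; lra).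
  assert (H3 := pow_div_fact_le_exp (1 + t) (2 * N) ltac:(lra)).
  apply Rle_trans with (4 * (1 + t) ^ (2 * N)).
  - replace (4 * (1 + t) ^ (2 * N)) with ((2 * (1 + t) ^ N) ^ 2).
    + apply pow_incr. split; [|lra]. assert (P := exp_pos (x * ln t)). unfold Rpower; lra.
    + rewrite (Nat.mul_comm 2 N), pow_mult; ring.
  - rewrite exp_plus in H3.
    apply Rmult_le_compat_r with (r := INR (Factorial.fact (2 * N))) in H3; [|lra].
    unfold Rdiv in H3; rewrite Rmult_assoc, Rinv_l, Rmult_1_r in H3 by lra.
    unfold c; lra.
Qed.

(* Up to a constant, [B] below is [c / x * t^x / (1 + t^x)]: it is bounded, and its derivative
   dominates the integrand. *)
Lemma RInt_gamma_integrand_bounded (x : R) :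
  0 < x -> exists M, forall a b, 0 < a -> a <= b -> RInt (gamma_integrand x) a b <= M.
Proof.
  intros Hx.
  destruct (Rpower_sqr_le_exp x Hx) as [c [Hc Hce]].
  exists (c / x); intros a b Ha Hab.
  set (B := fun t => - (c / x) / (1 + Rpower t x)).
  assert (HI : is_RInt (fun t => c * Rpower t (x - 1) / (1 + Rpower t x) ^ 2) a b (B b - B a)).
  { apply is_RInt_Rderive; [assumption| |]; intros t Ht;
      assert (P := exp_pos (x * ln t)).
    - unfold B, Rpower. auto_derive; [split; [lra|]; split; [lra|exact I]|].
      replace ((x - 1) * ln t) with (x * ln t + - ln t) by ring.
      rewrite exp_plus, exp_Ropp, exp_ln by lra.
      field; repeat split; lra.
    - apply (ex_derive_continuous (fun t => c * Rpower t (x - 1) / (1 + Rpower t x) ^ 2)).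
      unfold Rpower. auto_derive. repeat split; try lra.
      apply Rgt_not_eq. nra. }
  assert (Hb : forall t, 0 <= / (1 + Rpower t x) <= 1).
  { intros t. assert (P := exp_pos (x * ln t)). fold (Rpower t x) in P.
    split; [left; apply Rinv_0_lt_compat; lra|].
    rewrite <- Rinv_1; apply Rinv_le_contravar; lra. }
  apply Rle_trans with (B b - B a).
  - apply is_RInt_le with (2 := is_RInt_gamma_integrand x a b Ha Hab) (3 := HI); [assumption|].
    intros t Ht. unfold gamma_integrand.
    assert (P := exp_pos (x * ln t)). fold (Rpower t x) in P.
    assert (P1 : 0 < Rpower t (x - 1)) by apply exp_pos.
    specialize (Hce t ltac:(lra)).
    replace (c * Rpower t (x - 1) / (1 + Rpower t x) ^ 2)
      with (Rpower t (x - 1) * (c / (1 + Rpower t x) ^ 2)) by (field; lra).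
    apply Rmult_le_compat_l; [lra|].
    rewrite exp_Ropp.
    apply Rmult_le_reg_r with (exp t * (1 + Rpower t x) ^ 2).
    { apply Rmult_lt_0_compat; [apply exp_pos|apply pow_lt; lra]. }
    assert (Pt := exp_pos t).
    replace (/ exp t * (exp t * (1 + Rpower t x) ^ 2)) with ((1 + Rpower t x) ^ 2) by (field; lra).
    replace (c / (1 + Rpower t x) ^ 2 * (exp t * (1 + Rpower t x) ^ 2)) with (c * exp t)
      by (field; lra).
    exact Hce.
  - unfold B.
    assert (Hcx : 0 < c / x) by now apply Rdiv_lt_0_compat.
    assert (B1 := Hb a). assert (B2 := Hb b).
    replace (- (c / x) / (1 + Rpower b x) - - (c / x) / (1 + Rpower a x)) with
      (c / x * (/ (1 + Rpower a x) - / (1 + Rpower b x))).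
    + rewrite <- (Rmult_1_r (c / x)) at 2. apply Rmult_le_compat_l; lra.
    + unfold Rdiv; ring.
Qed.

(** The integrand is positive, so truncated integrals grow with the interval; being bounded, they
    approach their supremum, which is therefore the improper integral. *)
Lemma Gamma_approx (x eps : R) :
  0 < x -> 0 < eps ->
  exists a0 b0, 0 < a0 <= b0 /\ forall a b, 0 < a <= a0 -> b0 <= b ->
    Rabs (RInt (gamma_integrand x) a b - Gamma x) < eps.
Proof.
  intros Hx Heps.
  destruct (RInt_gamma_integrand_bounded x Hx) as [M HM].
  set (E := fun y => exists a b, 0 < a /\ a <= b /\ y = RInt (gamma_integrand x) a b).
  destruct (completeness E) as [l [Hub Hlub]].
  { exists M; intros y [a [b [Ha [Hab ->]]]]; now apply HM. }
  { exists (RInt (gamma_integrand x) 1 1), 1, 1; repeat split; lra. }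
  assert (Happ : forall eps, 0 < eps -> exists a0 b0, 0 < a0 <= b0 /\
    forall a b, 0 < a <= a0 -> b0 <= b ->
    Rabs (RInt (gamma_integrand x) a b - l) < eps).
  { clear eps Heps; intros eps Heps.
    destruct (Classical_Prop.classic (exists y, E y /\ l - eps < y)) as [[y [HE Hy]]|Hn].
    - destruct HE as [a0 [b0 [Ha0 [Hab0 ->]]]].
      exists a0, b0; split; [lra|]; intros a b Ha Hb.
      assert (H1 := RInt_gamma_integrand_mono x a a0 b0 b ltac:(lra) ltac:(lra) Hab0 Hb).
      assert (H2 : RInt (gamma_integrand x) a b <= l).
      { apply Hub. exists a, b; repeat split; lra. }
      apply Rabs_lt_between; lra.
    - assert (l <= l - eps); [|lra].
      apply Hlub; intros y Hy.
      apply Rnot_lt_le; intros Hlt; apply Hn; now exists y. }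
  assert (EG : Gamma x = l).
  { change (RInt_gen (gamma_integrand x) (at_right 0) (Rbar_locally p_infty) = l).
    apply (@is_RInt_gen_unique R_CompleteNormedModule (at_right 0) (Rbar_locally p_infty)
      _ _ (gamma_integrand x) l).
    intros P [d HP].
    destruct (Happ d (cond_pos d)) as [a0 [b0 [H0 H]]].
    apply Filter_prod with (Q := fun a => 0 < a <= a0) (R := fun b => b0 < b).
    - exists (mkposreal a0 (proj1 H0)); intros a Ha Ha'.
      apply Rabs_lt_between' in Ha; simpl in Ha. lra.
    - now exists b0.
    - intros a b Ha Hb. exists (RInt (gamma_integrand x) a b); split.
      + apply is_RInt_gamma_integrand; simpl; lra.
      + apply HP. apply H; lra. }
  rewrite EG. now apply Happ.
Qed.

(** A one-parameter exhaustion of (0, +oo), so that limits of sequences suffice from here on. *)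
Definition Gamma_trunc (x : R) (n : nat) : R :=
  RInt (gamma_integrand x) (/ INR (S n)) (INR (S n)).

Lemma inv_le_INR_S (n : nat) : 0 < / INR (S n) /\ / INR (S n) <= INR (S n).
Proof.
  assert (H : 1 <= INR (S n)) by (apply (le_INR 1); lia).
  split; [apply Rinv_0_lt_compat; lra|].
  apply Rle_trans with 1; [|assumption].
  rewrite <- Rinv_1; apply Rinv_le_contravar; lra.
Qed.

Lemma is_lim_seq_Gamma_trunc (x : R) : 0 < x -> is_lim_seq (Gamma_trunc x) (Gamma x).
Proof.
  intros Hx. apply is_lim_seq_spec. intros eps.
  destruct (Gamma_approx x eps Hx (cond_pos eps)) as [a0 [b0 [H0 H]]].
  destruct (INR_unbounded (Rmax (/ a0) b0)) as [N HN].
  exists N; intros n Hn.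
  assert (HnN : INR N <= INR (S n)) by (apply le_INR; lia).
  assert (M1 := Rmax_l (/ a0) b0). assert (M2 := Rmax_r (/ a0) b0).
  assert (Ia : 0 < / a0) by (apply Rinv_0_lt_compat; lra).
  apply H; [|lra].
  split; [apply inv_le_INR_S|].
  rewrite <- (Rinv_inv a0). apply Rinv_le_contravar; lra.
Qed.

Lemma Gamma_pos (x : R) : 0 < x -> 0 < Gamma x.
Proof.
  intros Hx.
  apply Rlt_le_trans with (RInt (gamma_integrand x) 1 2).
  - apply RInt_gt_0; [lra| |].
    + intros t _; apply gamma_integrand_pos.
    + intros t Ht; apply continuous_gamma_integrand; lra.
  - change (Rbar_le (RInt (gamma_integrand x) 1 2) (Gamma x)).
    apply is_lim_seq_le_loc with (u := fun _ => RInt (gamma_integrand x) 1 2) (v := Gamma_trunc x).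
    + exists 1%nat; intros n Hn.
      assert (H : 2 <= INR (S n)) by (apply (le_INR 2); lia).
      apply RInt_gamma_integrand_mono; try lra.
      * apply inv_le_INR_S.
      * rewrite <- Rinv_1; apply Rinv_le_contravar; lra.
    + apply is_lim_seq_const.
    + now apply is_lim_seq_Gamma_trunc.
Qed.

Lemma Gamma_trunc_rec (x : R) (n : nat) :
  Gamma_trunc (x + 1) n - x * Gamma_trunc x n =
  - Rpower (INR (S n)) x * exp (- INR (S n)) - - Rpower (/ INR (S n)) x * exp (- / INR (S n)).
Proof.
  destruct (inv_le_INR_S n) as [H0 H1].
  eapply is_RInt_Runique.
  { apply is_RInt_Rminus; [|apply is_RInt_Rscal]; apply is_RInt_gamma_integrand; assumption. }
  apply (is_RInt_Rderive (fun t => - Rpower t x * exp (- t))); [assumption| |]; intros t Ht.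
  - unfold gamma_integrand, Rpower. auto_derive; [lra|].
    replace ((x + 1 - 1) * ln t) with (x * ln t) by ring.
    replace ((x - 1) * ln t) with (x * ln t + - ln t) by ring.
    rewrite exp_plus, (exp_Ropp (ln t)), exp_ln by lra.
    field; lra.
  - apply (@continuous_minus R_UniformSpace R_AbsRing R_NormedModule (gamma_integrand (x + 1))).
    + apply continuous_gamma_integrand; lra.
    + apply continuous_Rscal, continuous_gamma_integrand; lra.
Qed.

Lemma is_lim_seq_inv_Rpower (x : R) :
  0 < x -> is_lim_seq (fun n => / Rpower (INR (S n)) x) 0.
Proof.
  intros Hx.
  change (Finite 0) with (Rbar_inv p_infty).
  apply is_lim_seq_inv; [|discriminate].
  unfold Rpower.
  assert (L : is_lim_seq (fun n => INR (S n)) p_infty).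
  { apply -> (is_lim_seq_incr_1 INR p_infty). apply is_lim_seq_INR. }
  apply (filterlim_comp _ _ _ (fun n => x * ln (INR (S n))) exp _ (Rbar_locally p_infty)).
  - apply is_lim_seq_mult with (l1 := x) (l2 := p_infty).
    + apply is_lim_seq_const.
    + exact (filterlim_comp _ _ _ _ ln _ _ _ L is_lim_ln_p).
    + simpl. unfold is_Rbar_mult. simpl.
      destruct (Rle_dec 0 x) as [H|H]; [|lra].
      destruct (Rle_lt_or_eq_dec 0 x H); [reflexivity|lra].
  - exact is_lim_exp_p.
Qed.

(** Both boundary terms of -t^x exp(-t), at N and at 1/N, are of order N^(-x): the first because
    N^(2x) <= c exp N, the second because (1/N)^x = N^(-x). *)
Lemma Gamma_succ (x : R) : 0 < x -> Gamma (x + 1) = x * Gamma x.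
Proof.
  intros Hx.
  assert (L : is_lim_seq (fun n => Gamma_trunc (x + 1) n - x * Gamma_trunc x n)
    (Gamma (x + 1) - x * Gamma x)).
  { apply is_lim_seq_minus'; [apply is_lim_seq_Gamma_trunc; lra|].
    apply (is_lim_seq_scal_l _ x (Gamma x)). now apply is_lim_seq_Gamma_trunc. }
  assert (L0 : is_lim_seq (fun n => Gamma_trunc (x + 1) n - x * Gamma_trunc x n) 0).
  { destruct (Rpower_sqr_le_exp x Hx) as [c [Hc Hce]].
    apply is_lim_seq_abs_0.
    apply is_lim_seq_le_le with (u := fun _ => 0) (w := fun n => (c + 1) * / Rpower (INR (S n)) x).
    - intros n; split; [apply Rabs_pos|].
      rewrite Gamma_trunc_rec.
      destruct (inv_le_INR_S n) as [H0 H1].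
      assert (Hn : 0 < INR (S n)) by lra.
      set (N := INR (S n)) in *.
      assert (EI : Rpower (/ N) x = / Rpower N x).
      { unfold Rpower. rewrite ln_Rinv, <- exp_Ropp by assumption. f_equal; ring. }
      rewrite EI.
      specialize (Hce N Hn).
      assert (PN : 0 < Rpower N x) by apply exp_pos.
      set (u := Rpower N x) in *.
      assert (Iu : 0 < / u) by now apply Rinv_0_lt_compat.
      assert (Ee : exp (- / N) <= 1).
      { rewrite <- exp_0. left; apply exp_increasing; lra. }
      assert (Ep := exp_pos (- / N)). assert (EN := exp_pos N).
      rewrite exp_Ropp.
      assert (IN : 0 < / exp N) by now apply Rinv_0_lt_compat.
      assert (B1 : u * / exp N <= c * / u).
      { apply Rmult_le_reg_r with (exp N * u); [nra|].
        replace (u * / exp N * (exp N * u)) with (u * u) by (field; lra).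
        replace (c * / u * (exp N * u)) with (c * exp N) by (field; lra).
        nra. }
      assert (B2 : / u * exp (- / N) <= / u) by nra.
      assert (B3 : 0 < / u * exp (- / N)) by now apply Rmult_lt_0_compat.
      assert (B4 : 0 < u * / exp N) by now apply Rmult_lt_0_compat.
      apply Rabs_le; split; nra.
    - apply is_lim_seq_const.
    - rewrite <- (Rmult_0_r (c + 1)).
      apply (is_lim_seq_scal_l _ _ 0). now apply is_lim_seq_inv_Rpower. }
  apply is_lim_seq_unique in L, L0. rewrite L in L0. apply Rbar_finite_eq in L0. lra.
Qed.

(* Weighted AM-GM, from [exp u >= 1 + u] at [- l (ln t - ln s)] and [(1 - l) (ln t - ln s)]. *)
Lemma Rpower_le_affine (s t l : R) :
  0 < s -> 0 < t -> 0 <= l <= 1 ->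
  Rpower t l <= Rpower s l * ((1 - l) + l / s * t).
Proof.
  intros Hs Ht Hl.
  set (y := ln t - ln s).
  assert (E1 := exp_ineq1_le (- (l * y))). assert (E2 := exp_ineq1_le (y + - (l * y))).
  assert (P := exp_pos (l * y)).
  assert (Ets : t / s = exp y).
  { unfold y, Rminus; rewrite exp_plus, exp_Ropp, !exp_ln by assumption. reflexivity. }
  assert (EA : Rpower t l = Rpower s l * exp (l * y)).
  { unfold Rpower; rewrite <- exp_plus. f_equal; unfold y; ring. }
  rewrite EA. apply Rmult_le_compat_l; [left; apply exp_pos|].
  replace (l / s * t) with (l * (t / s)) by (field; lra).
  rewrite Ets. rewrite exp_plus, exp_Ropp in E2. rewrite exp_Ropp in E1.
  assert (K : 1 <= (1 - l) * / exp (l * y) + l * (exp y * / exp (l * y))).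
  { apply Rle_trans with ((1 - l) * (1 + - (l * y)) + l * (1 + (y + - (l * y)))).
    - right; ring.
    - apply Rplus_le_compat; apply Rmult_le_compat_l; lra. }
  apply Rmult_le_compat_r with (r := exp (l * y)) in K; [|lra].
  rewrite Rmult_1_l in K. eapply Rle_trans; [exact K|].
  right; field; lra.
Qed.

(** Integrating t^l <= s^l ((1-l) + l t/s) against t^(s-1) exp(-t) gives s^l ((1-l) Gamma(s) + (l/s)
    Gamma(s+1)), and the functional equation collapses the bracket to Gamma(s). *)
Lemma Gamma_add_le (s l : R) :
  0 < s -> 0 <= l <= 1 -> Gamma (s + l) <= Rpower s l * Gamma s.
Proof.
  intros Hs Hl.
  replace (Rpower s l * Gamma s) with (Rpower s l * ((1 - l) * Gamma s + l / s * Gamma (s + 1))).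
  2: { rewrite Gamma_succ by assumption. field; lra. }
  assert (L : is_lim_seq (fun n => Rpower s l * ((1 - l) * Gamma_trunc s n + l / s * Gamma_trunc (s + 1) n))
    (Rpower s l * ((1 - l) * Gamma s + l / s * Gamma (s + 1)))).
  { apply (is_lim_seq_scal_l _ _ (Finite _)), is_lim_seq_plus';
      apply (is_lim_seq_scal_l _ _ (Finite _)), is_lim_seq_Gamma_trunc; lra. }
  change (Rbar_le (Gamma (s + l)) (Rpower s l * ((1 - l) * Gamma s + l / s * Gamma (s + 1)))).
  refine (is_lim_seq_le _ _ _ _ _ (is_lim_seq_Gamma_trunc (s + l) _) L); [|lra].
  intros n.
  destruct (inv_le_INR_S n) as [H0 H1].
  eapply is_RInt_le; [exact H1|apply is_RInt_gamma_integrand; assumption| |].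
  { apply is_RInt_Rscal, is_RInt_Rplus; apply is_RInt_Rscal;
      apply is_RInt_gamma_integrand; assumption. }
  intros t Ht. unfold gamma_integrand.
  assert (Hpos : 0 < t) by lra.
  assert (H := Rpower_le_affine s t l Hs Hpos Hl).
  replace (s + l - 1) with (s - 1 + l) by ring.
  replace (s + 1 - 1) with (s - 1 + 1) by ring.
  rewrite !Rpower_plus, Rpower_1 by assumption.
  assert (P : 0 < Rpower t (s - 1) * exp (- t)) by (apply Rmult_lt_0_compat; apply exp_pos).
  apply Rmult_le_compat_l with (r := Rpower t (s - 1) * exp (- t)) in H; [|lra].
  lra.
Qed.

Lemma ln_Gamma_succ (x : R) : 0 < x -> ln (Gamma (x + 1)) = ln x + ln (Gamma x).
Proof.
  intros Hx. rewrite Gamma_succ, ln_mult by auto using Gamma_pos. reflexivity.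
Qed.

Lemma ln_Gamma_add_le (s l : R) :
  0 < s -> 0 <= l <= 1 -> ln (Gamma (s + l)) <= l * ln s + ln (Gamma s).
Proof.
  intros Hs Hl.
  replace (l * ln s + ln (Gamma s)) with (ln (Rpower s l * Gamma s)).
  - apply ln_le; [apply Gamma_pos; lra|now apply Gamma_add_le].
  - rewrite ln_mult by (auto using Gamma_pos; apply exp_pos).
    unfold Rpower; now rewrite ln_exp.
Qed.

(* The [k = 0] term is [- ln y], as [ln 0 = 0]. *)
Definition ln_Gamma_term (k : nat) (y : R) : R :=
  y * (ln (INR (S k)) - ln (INR k)) - ln (y + INR k) + ln (INR k).

(** By the functional equation the terms ln(y+k) telescope to values of ln Gamma from y on, and the
    terms ln k to values from 1 on. *)
Lemma sum_ln_Gamma_term (y : R) (n : nat) :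
  0 < y ->
  sum_n (fun k => ln_Gamma_term k y) n =
  y * ln (INR (S n)) - (ln (Gamma (INR (S n) + y)) - ln (Gamma y))
  + (ln (Gamma (INR (S n))) - ln (Gamma 1)).
Proof.
  intros Hy; induction n as [|n IH].
  - rewrite sum_O. unfold ln_Gamma_term.
    change (INR 1) with 1; change (INR 0) with 0.
    rewrite (ln_nonpos_arg 0), ln_1, (Rplus_0_r y), (Rplus_comm 1 y), ln_Gamma_succ by lra.
    match goal with |- ?a = ?b => change (@eq R a b) end; ring.
  - rewrite sum_Sn, IH.
    match goal with |- plus ?a ?b = ?c => change (a + b = c) end.
    unfold ln_Gamma_term.
    assert (Hn : 0 < INR (S n)) by (apply lt_0_INR; lia).
    set (N := INR (S n)) in *.
    rewrite (S_INR (S n)); fold N.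
    replace (N + 1 + y) with (N + y + 1) by ring.
    rewrite !ln_Gamma_succ by lra.
    rewrite (Rplus_comm y). ring.
Qed.

(** The error y ln N - ln Gamma(N+y) + ln Gamma(N) is squeezed by two uses of [ln_Gamma_add_le]:
    step y from N makes it nonnegative, and step 1-y from N+y bounds it by (1-y) (ln(N+y) - ln N) <=
    1/N. The constant ln Gamma(1) is left unevaluated, as differentiation removes it. *)
Lemma is_series_ln_Gamma (y : R) :
  0 < y < 1 -> is_series (fun k => ln_Gamma_term k y) (ln (Gamma y) - ln (Gamma 1)).
Proof.
  intros Hy.
  change (is_lim_seq (sum_n (fun k => ln_Gamma_term k y)) (ln (Gamma y) - ln (Gamma 1))).
  rewrite <- (Rplus_0_r (ln (Gamma y) - ln (Gamma 1))).
  apply is_lim_seq_ext with (u := fun n => ln (Gamma y) - ln (Gamma 1) +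
    (y * ln (INR (S n)) - ln (Gamma (INR (S n) + y)) + ln (Gamma (INR (S n))))).
  { intros n; rewrite sum_ln_Gamma_term by lra. ring. }
  apply is_lim_seq_plus'; [apply is_lim_seq_const|].
  apply is_lim_seq_le_le with (u := fun _ => 0) (w := fun n => / INR (1 * n + 1)).
  - intros n. replace (1 * n + 1)%nat with (S n) by lia.
    assert (Hn : 0 < INR (S n)) by (apply lt_0_INR; lia).
    set (N := INR (S n)) in *.
    assert (H1 := ln_Gamma_add_le N y Hn ltac:(lra)).
    assert (H2 := ln_Gamma_add_le (N + y) (1 - y) ltac:(lra) ltac:(lra)).
    replace (N + y + (1 - y)) with (N + 1) in H2 by ring.
    rewrite ln_Gamma_succ in H2 by assumption.
    split; [lra|].
    assert (H3 := ln_diff_le N (N + y) Hn ltac:(lra)).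
    replace ((N + y - N) / N) with (y * / N) in H3 by (field; lra).
    assert (IN : 0 < / N) by now apply Rinv_0_lt_compat.
    apply Rle_trans with ((1 - y) * (ln (N + y) - ln N)); [lra|].
    apply Rle_trans with ((1 - y) * (y * / N)); [apply Rmult_le_compat_l; lra|].
    assert ((1 - y) * y <= 1) by nra. nra.
  - apply is_lim_seq_const.
  - apply is_lim_seq_inv_INR_affine; lia.
Qed.

(** * Digamma, polygamma and Hurwitz sums *)

Definition digamma_term (k : nat) (y : R) : R :=
  ln (INR (S k)) - ln (INR k) - / (y + INR k).

Lemma is_derive_ln_Gamma_term (k : nat) (y : R) :
  0 < y -> is_derive (ln_Gamma_term k) y (digamma_term k y).
Proof.
  intros Hy. assert (Hk := pos_INR k).
  unfold ln_Gamma_term, digamma_term.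
  set (A := ln (INR (S k))). set (B := ln (INR k)). set (K := INR k) in *.
  auto_derive; [lra|]. field; lra.
Qed.

Lemma is_derive_inv_shift_pow (k m : nat) (a c y : R) :
  0 < y ->
  is_derive (fun y => a + c * / (y + INR k) ^ S m) y
    (- c * INR (S m) * / (y + INR k) ^ S (S m)).
Proof.
  intros Hy. assert (Hk := pos_INR k).
  set (K := INR k) in *.
  assert (H : y + K <> 0) by lra.
  assert (Hm : (y + K) ^ m <> 0) by now apply pow_nonzero.
  apply is_derive_ext with (f := fun y => a + c * / ((y + K) * (y + K) ^ m)).
  { intros t; reflexivity. }
  auto_derive.
  - now apply Rmult_integral_contrapositive.
  - assert (E : INR m * (y + K) ^ Init.Nat.pred m = INR m * (y + K) ^ m / (y + K)).
    { destruct m as [|m]; [simpl; field; assumption|].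
      simpl Init.Nat.pred. change ((y + K) ^ S m) with ((y + K) * (y + K) ^ m).
      field; assumption. }
    rewrite E. rewrite S_INR.
    change ((y + K) ^ S (S m)) with ((y + K) * ((y + K) * (y + K) ^ m)).
    field; auto.
Qed.

Lemma is_derive_digamma_term (k : nat) (y : R) :
  0 < y -> is_derive (digamma_term k) y (/ (y + INR k) ^ 2).
Proof.
  intros Hy.
  assert (H := is_derive_inv_shift_pow k 0 (ln (INR (S k)) - ln (INR k)) (-1) y Hy).
  replace (/ (y + INR k) ^ 2) with (- -1 * INR 1 * / (y + INR k) ^ 2) by (simpl INR; ring).
  revert H; apply is_derive_ext; intros t.
  change (ln (INR (S k)) - ln (INR k) + -1 * / (t + INR k) ^ 1 = digamma_term k t).
  unfold digamma_term. rewrite pow_1. ring.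
Qed.

(** After the term k = 0 is dropped, ln((k+2)/(k+1)) and 1/(y+k+1) both lie between 1/(k+2) and
    1/(k+1), so their difference is dominated by a telescoping series. *)
Lemma ex_series_digamma_term (y : R) : 0 < y < 1 -> ex_series (fun k => digamma_term k y).
Proof.
  intros Hy. apply ex_series_incr_1.
  apply (@ex_series_le R_AbsRing R_CompleteNormedModule) with
    (b := fun k => / (1 + INR k) - / (1 + INR (S k))).
  - intros k. change (Rabs (digamma_term (S k) y) <= / (1 + INR k) - / (1 + INR (S k))).
    unfold digamma_term. rewrite !S_INR. assert (Hk := pos_INR k).
    set (K := INR k) in *.
    assert (H1 := ln_diff_le (K + 1) (K + 1 + 1) ltac:(lra) ltac:(lra)).
    assert (H2 := ln_diff_le (K + 1 + 1) (K + 1) ltac:(lra) ltac:(lra)).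
    replace ((K + 1 + 1 - (K + 1)) / (K + 1)) with (/ (1 + K)) in H1 by (field; lra).
    replace ((K + 1 - (K + 1 + 1)) / (K + 1 + 1)) with (- / (1 + (K + 1))) in H2 by (field; lra).
    assert (H3 : / (y + (K + 1)) <= / (1 + K)) by (apply Rinv_le_contravar; lra).
    assert (H4 : / (1 + (K + 1)) <= / (y + (K + 1))) by (apply Rinv_le_contravar; lra).
    apply Rabs_le; lra.
  - eexists. apply (is_series_telescope (fun k => / (1 + INR k))), is_lim_seq_inv_shift.
Qed.

(** This radius keeps t below 1, where the series holds, and above y/2, where the majorants hold. *)
Lemma Rabs_lt_half (y t : R) : Rabs (t - y) < Rmin (y / 2) (1 - y) -> y / 2 < t < 1.
Proof.
  intros H. apply Rabs_lt_between in H.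
  assert (M1 := Rmin_l (y / 2) (1 - y)). assert (M2 := Rmin_r (y / 2) (1 - y)). lra.
Qed.

Lemma Rinv_shift_pow_le (y t : R) (k m : nat) :
  0 < y -> y / 2 < t -> / (t + INR k) ^ m <= / (y / 2 + INR k) ^ m.
Proof.
  intros Hy Ht. assert (Hk := pos_INR k).
  apply Rinv_le_contravar; [apply pow_lt; lra|apply pow_incr; lra].
Qed.

(** Differentiability of Gamma is an outcome here: near y, Gamma is the exponential of a sum that is
    differentiable termwise, so its logarithmic derivative is the derived series. *)
Lemma is_series_digamma (y : R) :
  0 < y < 1 -> is_series (fun k => digamma_term k y) (digamma y).
Proof.
  intros Hy.
  assert (X : exists D : R, is_series (fun k => digamma_term k y) D)
    by exact (ex_series_digamma_term y Hy).
  destruct X as [D HD].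
  assert (Hd : 0 < Rmin (y / 2) (1 - y)) by (apply Rmin_glb_lt; lra).
  assert (HL : is_derive (fun t => ln (Gamma t) - ln (Gamma 1)) y D).
  { apply (is_derive_series ln_Gamma_term digamma_term (fun k t => / (t + INR k) ^ 2)
      (fun k => / (y / 2 + INR k) ^ 2) _ y (Rmin (y / 2) (1 - y)) D Hd).
    - intros k t Ht; apply Rabs_lt_half in Ht. apply is_derive_ln_Gamma_term; lra.
    - intros k t Ht; apply Rabs_lt_half in Ht. apply is_derive_digamma_term; lra.
    - intros k t Ht; apply Rabs_lt_half in Ht. assert (Hk := pos_INR k).
      rewrite Rabs_pos_eq by (left; apply Rinv_0_lt_compat, pow_lt; lra).
      apply Rinv_shift_pow_le; lra.
    - apply (ex_series_inv_shift_pow (y / 2) 0); lra.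
    - intros t Ht; apply Rabs_lt_half in Ht. apply is_series_ln_Gamma; lra.
    - exact HD. }
  assert (HG : is_derive Gamma y (Gamma y * D)).
  { apply is_derive_ext_loc with
      (f := fun t => exp (ln (Gamma 1) + (ln (Gamma t) - ln (Gamma 1)))).
    - exists (mkposreal y (proj1 Hy)); intros t Ht.
      apply Rabs_lt_between' in Ht; simpl in Ht.
      replace (ln (Gamma 1) + (ln (Gamma t) - ln (Gamma 1))) with (ln (Gamma t)) by ring.
      apply exp_ln, Gamma_pos; lra.
    - set (L := fun t => ln (Gamma t) - ln (Gamma 1)).
      change (is_derive L y D) in HL.
      assert (E : Gamma y = exp (ln (Gamma 1) + L y)).
      { unfold L. replace (ln (Gamma 1) + (ln (Gamma y) - ln (Gamma 1))) with (ln (Gamma y)) by ring.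
        symmetry; apply exp_ln, Gamma_pos; lra. }
      rewrite E.
      change (is_derive (fun t => exp (ln (Gamma 1) + L t)) y (exp (ln (Gamma 1) + L y) * D)).
      set (c := ln (Gamma 1)). clearbody L c.
      auto_derive; [eexists; exact HL|].
      replace (Derive (fun t => L t) y) with D by (symmetry; exact (is_derive_unique L y D HL)).
      ring. }
  replace (digamma y) with D; [exact HD|].
  unfold digamma. rewrite (is_derive_unique _ _ _ HG).
  assert (P := Gamma_pos y (proj1 Hy)). field; lra.
Qed.

Definition hurwitz (s : nat) (y : R) : R := Series (fun k => / (y + INR k) ^ s).

Lemma is_series_hurwitz (m : nat) (y : R) :
  0 < y -> is_series (fun k => / (y + INR k) ^ S (S m)) (hurwitz (S (S m)) y).
Proof. intros Hy; apply Series_correct, ex_series_inv_shift_pow, Hy. Qed.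

Lemma is_derive_digamma (y : R) : 0 < y < 1 -> is_derive digamma y (hurwitz 2 y).
Proof.
  intros Hy.
  assert (Hd : 0 < Rmin (y / 2) (1 - y)) by (apply Rmin_glb_lt; lra).
  apply (is_derive_series digamma_term (fun k t => / (t + INR k) ^ 2)
    (fun k t => -2 * / (t + INR k) ^ 3) (fun k => 2 * / (y / 2 + INR k) ^ 3)
    digamma y (Rmin (y / 2) (1 - y)) _ Hd).
  - intros k t Ht; apply Rabs_lt_half in Ht. apply is_derive_digamma_term; lra.
  - intros k t Ht; apply Rabs_lt_half in Ht.
    assert (H := is_derive_inv_shift_pow k 1 0 1 t ltac:(lra)).
    replace (-2 * / (t + INR k) ^ 3) with (- (1) * INR 2 * / (t + INR k) ^ 3)
      by (change (INR 2) with 2; ring).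
    revert H; apply is_derive_ext; intros u.
    change (0 + 1 * / (u + INR k) ^ 2 = / (u + INR k) ^ 2). ring.
  - intros k t Ht; apply Rabs_lt_half in Ht. assert (Hk := pos_INR k).
    rewrite Rabs_mult, (Rabs_left (-2)), Rabs_pos_eq by
      (try (left; apply Rinv_0_lt_compat, pow_lt); lra).
    replace (- -2) with 2 by ring.
    apply Rmult_le_compat_l; [lra|]. apply Rinv_shift_pow_le; lra.
  - apply (ex_series_scal 2 (fun k => / (y / 2 + INR k) ^ 3)).
    apply (ex_series_inv_shift_pow (y / 2) 1); lra.
  - intros t Ht; apply Rabs_lt_half in Ht. apply is_series_digamma; lra.
  - apply (is_series_hurwitz 0); lra.
Qed.

Lemma is_derive_hurwitz (m : nat) (y : R) :
  0 < y < 1 ->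
  is_derive (hurwitz (S (S m))) y (- INR (S (S m)) * hurwitz (S (S (S m))) y).
Proof.
  intros Hy.
  assert (Hd : 0 < Rmin (y / 2) (1 - y)) by (apply Rmin_glb_lt; lra).
  set (s := S (S m)).
  assert (D1 : forall (j k : nat) (c t : R), 0 < t ->
    is_derive (fun u => c * / (u + INR k) ^ S j) t (- c * INR (S j) * / (t + INR k) ^ S (S j))).
  { intros j k c t Ht.
    assert (H := is_derive_inv_shift_pow k j 0 c t Ht).
    revert H; apply is_derive_ext; intros u.
    change (0 + c * / (u + INR k) ^ S j = c * / (u + INR k) ^ S j). ring. }
  apply (is_derive_series (fun k t => 1 * / (t + INR k) ^ s)
    (fun k t => - (1) * INR s * / (t + INR k) ^ S s)
    (fun k t => - (- (1) * INR s) * INR (S s) * / (t + INR k) ^ S (S s))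
    (fun k => INR s * INR (S s) * / (y / 2 + INR k) ^ S (S s))
    _ y (Rmin (y / 2) (1 - y)) _ Hd).
  - intros k t Ht; apply Rabs_lt_half in Ht. apply D1; lra.
  - intros k t Ht; apply Rabs_lt_half in Ht. apply D1; lra.
  - intros k t Ht; apply Rabs_lt_half in Ht. assert (Hk := pos_INR k).
    assert (P1 := pos_INR s). assert (P2 := pos_INR (S s)).
    replace (- (- (1) * INR s) * INR (S s)) with (INR s * INR (S s)) by ring.
    assert (P3 : 0 <= INR s * INR (S s)) by now apply Rmult_le_pos.
    rewrite Rabs_mult, !Rabs_pos_eq; [|left; apply Rinv_0_lt_compat, pow_lt; lra|assumption].
    apply Rmult_le_compat_l; [assumption|]. apply Rinv_shift_pow_le; lra.
  - apply (ex_series_scal (INR s * INR (S s)) (fun k => / (y / 2 + INR k) ^ S (S s))).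
    apply (ex_series_inv_shift_pow (y / 2) s); lra.
  - intros t Ht; apply Rabs_lt_half in Ht.
    apply is_series_Rext with (a := fun k => / (t + INR k) ^ s); [intros k; ring|].
    apply is_series_hurwitz; lra.
  - replace (- INR s) with (- (1) * INR s) by ring.
    apply is_series_Rscal. apply is_series_hurwitz; lra.
Qed.

(** [Derive_n] differentiates the previous derivative as a function, so the induction hypothesis is
    used on a whole neighbourhood of y. *)
Lemma polygamma_hurwitz (m : nat) (y : R) :
  0 < y < 1 ->
  polygamma (S m) y = (-1) ^ m * INR (Factorial.fact (S m)) * hurwitz (S (S m)) y.
Proof.
  revert y; induction m as [|m IH]; intros y Hy; unfold polygamma in *.
  - simpl Derive_n. change (Derive digamma y = 1 * 1 * hurwitz 2 y).
    rewrite (is_derive_unique _ _ _ (is_derive_digamma y Hy)). ring.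
  - change (Derive (Derive_n digamma (S m)) y =
      (-1) ^ S m * INR (Factorial.fact (S (S m))) * hurwitz (S (S (S m))) y).
    apply is_derive_unique.
    apply is_derive_ext_loc with
      (f := fun t => (-1) ^ m * INR (Factorial.fact (S m)) * hurwitz (S (S m)) t).
    + assert (Hd : 0 < Rmin (y / 2) (1 - y)) by (apply Rmin_glb_lt; lra).
      exists (mkposreal _ Hd); intros t Ht; apply Rabs_lt_half in Ht.
      symmetry; apply IH; lra.
    + replace ((-1) ^ S m * INR (Factorial.fact (S (S m))) * hurwitz (S (S (S m))) y) with
        ((-1) ^ m * INR (Factorial.fact (S m)) * (- INR (S (S m)) * hurwitz (S (S (S m))) y)).
      * apply (is_derive_scal (hurwitz (S (S m)))). now apply is_derive_hurwitz.
      * rewrite (fact_simpl (S m)), mult_INR. simpl ((-1) ^ S m). ring.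
Qed.

(** The positive terms have denominators 4k+1 = 4(k + 1/4), the negative ones 4k+3 = 4(k + 3/4).
    Each term of the Hurwitz difference pairs two consecutive terms of beta. *)
Lemma beta_hurwitz (m : nat) :
  beta (S (S m)) * 4 ^ S (S m) = hurwitz (S (S m)) (1 / 4) - hurwitz (S (S m)) (3 / 4).
Proof.
  set (s := S (S m)).
  assert (H4 : 4 ^ s <> 0) by (apply pow_nonzero; lra).
  assert (Hq : is_series (fun k => / (1 / 4 + INR k) ^ s + -1 * / (3 / 4 + INR k) ^ s)
    (hurwitz s (1 / 4) + -1 * hurwitz s (3 / 4))).
  { apply is_series_Rplus; [|apply is_series_Rscal]; apply is_series_hurwitz; lra. }
  replace (hurwitz s (1 / 4) - hurwitz s (3 / 4)) with
    (hurwitz s (1 / 4) + -1 * hurwitz s (3 / 4)) by ring.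
  assert (Hb := is_series_beta (S m)). fold s in Hb.
  apply (is_series_Rscal _ (4 ^ s)) in Hb. rewrite (Rmult_comm (4 ^ s)) in Hb.
  set (b := fun j => 4 ^ s * ((-1) ^ j / INR (2 * j + 1) ^ s)) in *.
  assert (E : forall N, sum_n (fun k => / (1 / 4 + INR k) ^ s + -1 * / (3 / 4 + INR k) ^ s) N
    = sum_n b (2 * N + 1)).
  { assert (Ev : forall N, b (2 * N)%nat = / (1 / 4 + INR N) ^ s).
    { intros N. unfold b. rewrite pow_1_even.
      replace (1 / 4 + INR N) with (INR (2 * (2 * N) + 1) * / 4).
      - rewrite Rpow_mult_distr, pow_inv.
        field. repeat split; try assumption. apply pow_nonzero, not_0_INR; lia.
      - rewrite plus_INR, !mult_INR. simpl INR. field. }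
    assert (Od : forall N, b (2 * N + 1)%nat = -1 * / (3 / 4 + INR N) ^ s).
    { intros N. unfold b. rewrite pow_add, pow_1_even.
      replace (3 / 4 + INR N) with (INR (2 * (2 * N + 1) + 1) * / 4).
      - rewrite Rpow_mult_distr, pow_inv.
        field. repeat split; try assumption. apply pow_nonzero, not_0_INR; lia.
      - rewrite plus_INR, mult_INR, plus_INR, mult_INR. simpl INR. field. }
    induction N as [|N IH].
    - rewrite sum_O. change (2 * 0 + 1)%nat with 1%nat. rewrite sum_Sn, sum_O.
      assert (E0 := Ev 0%nat). assert (E1 := Od 0%nat).
      change (2 * 0)%nat with 0%nat in E0. change (2 * 0 + 1)%nat with 1%nat in E1.
      rewrite E0, E1. reflexivity.
    - replace (2 * S N + 1)%nat with (S (S (2 * N + 1))) by lia.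
      rewrite !sum_Sn, IH.
      replace (S (S (2 * N + 1))) with (2 * S N + 1)%nat by lia.
      replace (S (2 * N + 1)) with (2 * S N)%nat by lia.
      rewrite Ev, Od. unfold plus; cbn -[Nat.mul sum_n Nat.add pow INR]. ring. }
  assert (Hphi : filterlim (fun N => (2 * N + 1)%nat) eventually eventually).
  { apply eventually_subseq; intros N; lia. }
  assert (L : is_series (fun k => / (1 / 4 + INR k) ^ s + -1 * / (3 / 4 + INR k) ^ s)
    (beta s * 4 ^ s)).
  { change (is_lim_seq
      (sum_n (fun k => / (1 / 4 + INR k) ^ s + -1 * / (3 / 4 + INR k) ^ s)) (beta s * 4 ^ s)).
    apply is_lim_seq_ext with (u := fun N => sum_n b (2 * N + 1)); [intros N; now rewrite E|].
    apply (is_lim_seq_subseq (sum_n b) _ _ Hphi). exact Hb. }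
  exact (is_series_unique_R _ _ _ L Hq).
Qed.

Lemma beta_even_polygamma (j : nat) :
  beta (2 * S j) = / (4 ^ (2 * S j) * INR (Factorial.fact (2 * S j - 1)))
    * (polygamma (2 * S j - 1) (1 / 4) - polygamma (2 * S j - 1) (3 / 4)).
Proof.
  replace (2 * S j)%nat with (S (S (2 * j))) by lia.
  replace (S (S (2 * j)) - 1)%nat with (S (2 * j)) by lia.
  rewrite !polygamma_hurwitz by lra. rewrite pow_1_even, !Rmult_1_l.
  rewrite <- Rmult_minus_distr_l, <- beta_hurwitz.
  field. split; [apply INR_fact_neq_0|apply pow_nonzero; lra].
Qed.

(** * Rational spans *)

Definition Qcomb (f : nat -> R) (a b : nat) (l : nat -> Q) : R :=
  sum_n_m (fun i => Q2R (l i) * f i) a b.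

Lemma Q2R_0 : Q2R 0 = 0.
Proof. unfold Q2R; simpl; field. Qed.

Lemma Q2R_1 : Q2R 1 = 1.
Proof. unfold Q2R; simpl; field. Qed.

Lemma Qcomb_plus (f : nat -> R) (a b : nat) (l l' : nat -> Q) :
  Qcomb f a b (fun i => l i + l' i)%Q = Qcomb f a b l + Qcomb f a b l'.
Proof.
  unfold Qcomb. rewrite <- (@sum_n_m_plus R_AbelianMonoid).
  apply sum_n_m_ext; intros i. rewrite Q2R_plus. apply Rmult_plus_distr_r.
Qed.

Lemma Qcomb_scal (f : nat -> R) (a b : nat) (c : Q) (l : nat -> Q) :
  Qcomb f a b (fun i => c * l i)%Q = Q2R c * Qcomb f a b l.
Proof.
  unfold Qcomb. rewrite <- (@sum_n_m_mult_l R_Ring).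
  apply sum_n_m_ext; intros i. rewrite Q2R_mult. apply Rmult_assoc.
Qed.

Definition delta (i j : nat) : Q := if Nat.eqb i j then 1%Q else 0%Q.

Lemma Qcomb_0 (f : nat -> R) (a b : nat) (l : nat -> Q) :
  (forall i, (a <= i <= b)%nat -> l i = 0%Q) -> Qcomb f a b l = 0.
Proof.
  intros H. unfold Qcomb.
  transitivity (sum_n_m (fun _ => zero : R_AbelianMonoid) a b).
  - apply sum_n_m_ext_loc; intros i Hi. rewrite (H i Hi), Q2R_0. apply Rmult_0_l.
  - apply (@sum_n_m_const_zero R_AbelianMonoid).
Qed.

Lemma Qcomb_delta (f : nat -> R) (a b i : nat) :
  (a <= i <= b)%nat -> Qcomb f a b (delta i) = f i.
Proof.
  intros Hi. unfold Qcomb, delta.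
  assert (H : forall c, (i <= c)%nat ->
    sum_n_m (fun j => Q2R (if Nat.eqb i j then 1%Q else 0%Q) * f j) a c = f i).
  { induction c as [|c IH]; intros Hc.
    - replace i with 0%nat in * by lia. replace a with 0%nat by lia.
      rewrite sum_n_n, Nat.eqb_refl, Q2R_1. apply Rmult_1_l.
    - destruct (Nat.eq_dec i (S c)) as [E|E].
      + rewrite sum_n_Sm by lia. rewrite <- E, Nat.eqb_refl, Q2R_1.
        fold (Qcomb f a c (fun j => if Nat.eqb i j then 1%Q else 0%Q)).
        rewrite Qcomb_0.
        * change (0 + 1 * f i = f i); ring.
        * intros j Hj. destruct (Nat.eqb_spec i j) as [E'|E']; [lia|reflexivity].
      + rewrite sum_n_Sm by lia. rewrite IH by lia.
        destruct (Nat.eqb_spec i (S c)) as [E'|E']; [lia|].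
        rewrite Q2R_0. change (f i + 0 * f (S c) = f i); ring. }
  apply H; lia.
Qed.

Lemma lnfrac_span (V : R -> Prop) (m P r p i : nat) :
  Qsubspace V -> V 1 -> (forall p, (p <= P)%nat -> V (lnint (S m) p 1)) ->
  (p <= P)%nat -> (1 <= r)%nat ->
  exists x, V x /\ is_RInt (lnfrac (S m + 2 * i) p r) 0 1 x.
Proof.
  intros HV H1 Hb Hp Hr.
  exists (lnint (S m + 2 * i) p r); split; [|apply (is_RInt_lnint (m + 2 * i))].
  destruct r as [|r]; [lia|].
  apply (Qsubspace_lnint V (m + 2 * i) P); auto.
  intros p' Hp'. apply (Qsubspace_lnint_shift V m); auto.
Qed.

Definition zeta_form (q : nat) (l : nat -> Q) : R :=
  Q2R (l 0%nat) * ln 2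
        + sum_n_m (fun i : nat => Q2R (l i) * zeta (INR (i + 1))) 1 q
        + Q2R (l (q + 1)%nat).

(** The range of the PI powers has its own bound [K], which is k for the odd power of the logarithm
    and k+1 for the even one. *)
Definition beta_form (K k : nat) (l c : nat -> Q) : R :=
  Q2R (l 0%nat) * catalan
        + sum_n_m (fun i : nat => Q2R (l i) * PI ^ (2 * i - 1)) 1 K
        + sum_n_m (fun j : nat => Q2R (c j) *
            (polygamma (2 * j - 1) (1 / 4) - polygamma (2 * j - 1) (3 / 4))) 2 k
        + Q2R (l (K + 1)%nat).

Lemma zeta_form_Qcomb (q : nat) (l : nat -> Q) :
  zeta_form q l = Q2R (l 0%nat) * ln 2 + Qcomb (fun i => zeta (INR (i + 1))) 1 q l
    + Q2R (l (q + 1)%nat).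
Proof. reflexivity. Qed.

Lemma beta_form_Qcomb (K k : nat) (l c : nat -> Q) :
  beta_form K k l c = Q2R (l 0%nat) * catalan + Qcomb (fun i => PI ^ (2 * i - 1)) 1 K l
    + Qcomb (fun j => polygamma (2 * j - 1) (1 / 4) - polygamma (2 * j - 1) (3 / 4)) 2 k c
    + Q2R (l (K + 1)%nat).
Proof. reflexivity. Qed.

Definition zeta_span (q : nat) (x : R) : Prop := exists l, x = zeta_form q l.

Definition beta_span (K k : nat) (x : R) : Prop := exists l c, x = beta_form K k l c.

Lemma zeta_span_Qsubspace (q : nat) : Qsubspace (zeta_span q).
Proof.
  split.
  - intros x y [l ->] [l' ->]. exists (fun i => l i + l' i)%Q.
    rewrite !zeta_form_Qcomb, Qcomb_plus, !Q2R_plus. ring.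
  - intros a x [l ->]. exists (fun i => a * l i)%Q.
    rewrite !zeta_form_Qcomb, Qcomb_scal, !Q2R_mult. ring.
Qed.

Lemma beta_span_Qsubspace (K k : nat) : Qsubspace (beta_span K k).
Proof.
  split.
  - intros x y [l [c ->]] [l' [c' ->]].
    exists (fun i => l i + l' i)%Q, (fun i => c i + c' i)%Q.
    rewrite !beta_form_Qcomb, !Qcomb_plus, !Q2R_plus. ring.
  - intros a x [l [c ->]].
    exists (fun i => a * l i)%Q, (fun i => a * c i)%Q.
    rewrite !beta_form_Qcomb, !Qcomb_scal, !Q2R_mult. ring.
Qed.

Lemma delta_refl (i : nat) : Q2R (delta i i) = 1.
Proof. unfold delta; rewrite Nat.eqb_refl; apply Q2R_1. Qed.

Lemma delta_neq (i j : nat) : i <> j -> delta i j = 0%Q.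
Proof. intros H; unfold delta; now destruct (Nat.eqb_spec i j). Qed.

Lemma zeta_span_1 (q : nat) : zeta_span q 1.
Proof.
  exists (delta (q + 1)). rewrite zeta_form_Qcomb, Qcomb_0, delta_refl, delta_neq, Q2R_0; try lia.
  - ring.
  - intros i Hi; apply delta_neq; lia.
Qed.

Lemma zeta_span_ln2 (q : nat) : zeta_span q (ln 2).
Proof.
  exists (delta 0). rewrite zeta_form_Qcomb, Qcomb_0, delta_refl, delta_neq, Q2R_0; try lia.
  - ring.
  - intros i Hi; apply delta_neq; lia.
Qed.

Lemma zeta_span_zeta (q i : nat) : (1 <= i <= q)%nat -> zeta_span q (zeta (INR (i + 1))).
Proof.
  intros Hi. exists (delta i).
  rewrite zeta_form_Qcomb, Qcomb_delta, !delta_neq, Q2R_0 by lia. ring.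
Qed.

Lemma beta_span_1 (K k : nat) : beta_span K k 1.
Proof.
  exists (delta (K + 1)), (fun _ => 0%Q).
  rewrite beta_form_Qcomb, !Qcomb_0, delta_refl, delta_neq, Q2R_0; auto; try lia.
  - ring.
  - intros i Hi; apply delta_neq; lia.
Qed.

Lemma beta_span_catalan (K k : nat) : beta_span K k catalan.
Proof.
  exists (delta 0), (fun _ => 0%Q).
  rewrite beta_form_Qcomb, !Qcomb_0, delta_refl, delta_neq, Q2R_0; auto; try lia.
  - ring.
  - intros i Hi; apply delta_neq; lia.
Qed.

Lemma beta_span_PI (K k i : nat) : (1 <= i <= K)%nat -> beta_span K k (PI ^ (2 * i - 1)).
Proof.
  intros Hi. exists (delta i), (fun _ => 0%Q).
  rewrite beta_form_Qcomb, Qcomb_delta, Qcomb_0, !delta_neq, Q2R_0; auto; try lia.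
  ring.
Qed.

Lemma beta_span_polygamma (K k j : nat) :
  (2 <= j <= k)%nat ->
  beta_span K k (polygamma (2 * j - 1) (1 / 4) - polygamma (2 * j - 1) (3 / 4)).
Proof.
  intros Hj. exists (fun _ => 0%Q), (delta j).
  rewrite beta_form_Qcomb, Qcomb_delta, Qcomb_0, Q2R_0; auto; try lia.
  ring.
Qed.

Lemma zeta_span_lnint (q p : nat) : (p <= q)%nat -> zeta_span q (lnint 1 p 1).
Proof.
  intros Hp. assert (HV := zeta_span_Qsubspace q).
  destruct p as [|p].
  - rewrite lnint_1_0_1. apply Qsubspace_scal; auto with rational. apply zeta_span_ln2.
  - rewrite lnint_1_zeta. apply Qsubspace_scal; auto 10 with rational.
    apply zeta_span_zeta; lia.
Qed.

(** For p = 2i the value is a rational multiple of PI^(2(i+1)-1), which requires i+1 <= K. For p =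
    2i+1 it is Catalan's constant if i = 0, and otherwise a multiple of the polygamma difference
    with index i+1, which lies between 2 and k. *)
Lemma beta_span_beta (K k p : nat) :
  (p <= 2 * k)%nat -> (forall i, p = (2 * i)%nat -> (i < K)%nat) -> beta_span K k (beta (S p)).
Proof.
  intros Hk HK. assert (HV := beta_span_Qsubspace K k).
  destruct (Nat.Even_or_Odd p) as [[i E]|[i E]].
  - subst p. destruct (beta_odd_rational_PI i) as [a [Ha ->]].
    apply Qsubspace_scal; auto.
    replace (S (2 * i)) with (2 * (S i) - 1)%nat by lia.
    apply beta_span_PI. specialize (HK i eq_refl); lia.
  - subst p. replace (S (2 * i + 1)) with (2 * S i)%nat by lia.
    destruct i as [|i].
    + change (beta (2 * 1)) with catalan. apply beta_span_catalan.
    + rewrite beta_even_polygamma. apply Qsubspace_scal; auto with rational.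
      apply beta_span_polygamma; lia.
Qed.

Lemma beta_span_lnint (K k p : nat) :
  beta_span K k (beta (S p)) -> beta_span K k (lnint 2 p 1).
Proof.
  intros H. assert (HV := beta_span_Qsubspace K k).
  rewrite lnint_2_beta.
  apply Qsubspace_scal; auto with rational.
  apply (Qsub_add _ HV); [apply beta_span_1|].
  replace (- beta (S p)) with (-1 * beta (S p)) by ring.
  apply Qsubspace_scal; auto with rational.
Qed.

Theorem theorem4 (r n q k : nat)
    (hr : (1 <= r)%nat) (hn : (1 <= n)%nat)
    (hq : (1 <= q)%nat) (hk : (1 <= k)%nat) :
  (exists l : nat -> Q,
     is_RInt (fun x : R => x ^ (2 * n - 1) * ln x ^ q / (1 + x ^ 2) ^ r) 0 1
       (Q2R (l 0%nat) * ln 2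
        + sum_n_m (fun i : nat => Q2R (l i) * zeta (INR (i + 1))) 1 q
        + Q2R (l (q + 1)%nat)))
  /\
  (exists l c : nat -> Q,
     is_RInt (fun x : R => x ^ (2 * n) * ln x ^ (2 * k - 1) / (1 + x ^ 2) ^ r) 0 1
       (Q2R (l 0%nat) * catalan
        + sum_n_m (fun i : nat => Q2R (l i) * PI ^ (2 * i - 1)) 1 k
        + sum_n_m (fun j : nat => Q2R (c j) *
            (polygamma (2 * j - 1) (1 / 4) - polygamma (2 * j - 1) (3 / 4))) 2 k
        + Q2R (l (k + 1)%nat)))
  /\
  (exists l c : nat -> Q,
     is_RInt (fun x : R => x ^ (2 * n) * ln x ^ (2 * k) / (1 + x ^ 2) ^ r) 0 1
       (Q2R (l 0%nat) * catalan
        + sum_n_m (fun i : nat => Q2R (l i) * PI ^ (2 * i - 1)) 1 (k + 1)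
        + sum_n_m (fun j : nat => Q2R (c j) *
            (polygamma (2 * j - 1) (1 / 4) - polygamma (2 * j - 1) (3 / 4))) 2 k
        + Q2R (l (k + 2)%nat))).
Proof.
  destruct n as [|n]; [lia|].
  replace (2 * S n - 1)%nat with (1 + 2 * n)%nat by lia.
  replace (2 * S n)%nat with (2 + 2 * n)%nat by lia.
  split; [|split].
  - destruct (lnfrac_span (zeta_span q) 0 q r q n) as [x [[l ->] H]];
      auto using zeta_span_Qsubspace, zeta_span_1, zeta_span_lnint.
    now exists l.
  - destruct (lnfrac_span (beta_span k k) 1 (2 * k - 1) r (2 * k - 1) n) as [x [[l [c ->]] H]];
      auto using beta_span_Qsubspace, beta_span_1.
    (* Here p <= 2k-1, so an even p is at most 2k-2 and the powers stop at PI^(2k-1). *)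
    + intros p Hp. apply beta_span_lnint, beta_span_beta; lia.
    + now exists l, c.
  - destruct (lnfrac_span (beta_span (k + 1) k) 1 (2 * k) r (2 * k) n) as [x [[l [c ->]] H]];
      auto using beta_span_Qsubspace, beta_span_1.
    (* Now p = 2k occurs and brings in PI^(2k+1), hence the bound k+1. *)
    + intros p Hp. apply beta_span_lnint, beta_span_beta; lia.
    + exists l, c. replace (k + 2)%nat with (k + 1 + 1)%nat by lia. exact H.
Qed.
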